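(* Let $1\le p\le 2$, let $M$ be an Orlicz function and let $f\in L_p$ be a mean zero random variable. Then a sequence $\{f_k\}_{k=1}^\infty$ of independent copies of $f$ is equivalent in $L_p$ to the unit vector basis of $l_M$ if and only if $$\frac1{M^{-1}(t)}\sim\left(\frac1t\int_0^t f^*(s)^p\,ds\right)^{1/p}+\left(\frac1t\int_t^1 f^*(s)^2\,ds\right)^{1/2},\qquad 0<t\le1.$$
   Context: $L_p=L_p[0,1]$ with Lebesgue measure $\lambda$; random variables are measurable functions on $[0,1]$ (independent copies may be realized on any sufficiently rich probability space). An Orlicz function is an increasing convex function $M:[0,\infty)\to[0,\infty)$ with $M(0)=0$; throughout $M$ is assumed to satisfy $M(1)=1$ and to be a bijection of $[0,\infty)$. $l_M$ is the Orlicz sequence space with norm $\|a\|_{l_M}=\inf\{\rho>0:\sum_{n}M(|a_n|/\rho)\le1\}$, and $e_k$ are the standard unit vectors. A sequence $\{f_k\}$ is equivalent in $L_p$ to the unit vector basis of $l_M$ if there is $C>0$ with $C^{-1}\|a\|_{l_M}\le\|\sum_k a_kf_k\|_p\le C\|a\|_{l_M}$ for all finitely supported scalar sequences $a=(a_k)$. $n_f(\tau)=\lambda\{u:|f(u)|>\tau\}$ and $f^*(s)=\inf\{t: n_f(t)\le s\}$ is the non-increasing right-continuous rearrangement of $f$. For nonnegative functions, $F\sim G$ on a set means $C^{-1}F\le G\le CF$ on that set for some constant $0<C<\infty$. *)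

(* Defs.v *)
From HB Require Import structures.
From mathcomp Require Import all_boot all_order all_algebra.
From mathcomp Require Import all_classical all_reals all_analysis.

Set Implicit Arguments.
Unset Strict Implicit.
Unset Printing Implicit Defensive.

Import Order.TTheory GRing.Theory Num.Theory.
Import numFieldNormedType.Exports.

Local Open Scope classical_set_scope.
Local Open Scope ring_scope.

(* A function on [0, oo) is encoded by a function R -> R whose values at
   negative arguments are irrelevant. *)
Record orlicz_function (R : realType) (M : R -> R) : Prop := OrliczFunction {
  orlicz_bij : set_bij `[0, +oo[%classic `[0, +oo[%classic M ;
  orlicz_incr : {in `[0, +oo[%classic &, {homo M : x y / x < y}} ;
  orlicz_convex : convex_function (`[0, +oo[%classic : set R) M ;
  orlicz0 : M 0 = 0 ;
  orlicz1 : M 1 = 1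
}.

Definition orlicz_inv (R : realType) (M : R -> R) : R -> R :=
  'pinv_(fun=> 0) `[0, +oo[%classic M.

(* The value is +oo when the set of admissible rho is empty. *)
Definition orlicz_norm (R : realType) (M : R -> R) (a : nat -> R) : \bar R :=
  ereal_inf [set rho%:E | rho in [set rho : R |
    0 < rho /\ (\sum_(0 <= k <oo) (M (`|a k| / rho))%:E <= 1)%E]].

(* A random variable on [0, 1] is encoded by a function R -> R whose values
   outside [0, 1] are irrelevant; L_p membership is that of its extension
   by 0. *)
Definition in_Lp01 (R : realType) (p : R) (f : R -> R) : Prop :=
  f \_ `[0, 1] \in Lfun (@lebesgue_measure R) p%:E.

Definition mean_zero01 (R : realType) (f : R -> R) : Prop :=
  (\int[@lebesgue_measure R]_(u in `[0%R, 1%R]) (f u)%:E = 0)%E.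

Definition distr_fun (R : realType) (f : R -> R) (tau : R) : \bar R :=
  lebesgue_measure (`[0, 1] `&` [set u : R | tau < `|f u|]).

(* The infimum is over t >= 0; the value is +oo at s = 0 when f is
   essentially unbounded. *)
Definition rearrangement (R : realType) (f : R -> R) (s : R) : \bar R :=
  ereal_inf [set t%:E | t in [set t : R |
    0 <= t /\ (distr_fun f t <= s%:E)%E]].

Definition mutually_independent (R : realType) (d : measure_display)
    (T : measurableType d) (P : probability T R) (X : nat -> {RV P >-> R}) :
    Prop :=
  forall (J : seq nat) (B : nat -> set R),
    uniq J -> (forall k, measurable (B k)) ->
    P [set w | forall k, k \in J -> B k (X k w)] =
      (\prod_(k <- J) P (X k @^-1` B k))%E.

Definition independent_copies (R : realType) (d : measure_display)
    (T : measurableType d) (P : probability T R) (f : R -> R)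
    (X : nat -> {RV P >-> R}) : Prop :=
  mutually_independent X /\
  (forall (k : nat) (B : set R), measurable B ->
    distribution P (X k) B = lebesgue_measure (`[0, 1] `&` f @^-1` B)).

(* "a k = 0 for all k >= n" makes the finite support of a explicit. *)
Definition equiv_unit_basis (R : realType) (d : measure_display)
    (T : measurableType d) (P : probability T R) (p : R) (M : R -> R)
    (X : nat -> {RV P >-> R}) : Prop :=
  exists2 C : R, 0 < C &
    forall (n : nat) (a : nat -> R), (forall k, (n <= k)%N -> a k = 0) ->
      ((C^-1)%:E * orlicz_norm M a <=
         'N[P]_(p%:E)[EFin \o (fun w => \sum_(k < n) a k * X k w)%R])%E /\
      ('N[P]_(p%:E)[EFin \o (fun w => \sum_(k < n) a k * X k w)%R] <=
         C%:E * orlicz_norm M a)%E.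

Definition asymp_on (R : realType) (D : set R) (F G : R -> \bar R) : Prop :=
  exists2 C : R, 0 < C &
    forall t, D t -> ((C^-1)%:E * F t <= G t)%E /\ (G t <= C%:E * F t)%E.

(* Main.v *)
Require Import Defs.
From HB Require Import structures.
From mathcomp Require Import all_boot all_order all_algebra.
From mathcomp Require Import all_classical all_reals all_analysis.
From mathcomp Require Import measurable_realfun.
From mathcomp Require Import ring lra.

(** Let S = sum_k a_k X_k, let phi u = min(u^2, |u|^p) and
    Phi x = E phi(x X_0). Everything rests on the estimate that E|S|^p is
    bounded iff sum_k Phi(a_k) is, which says that (X_k) spans the Orlicz
    space of Phi. It is obtained from psi u = (1 + u^2)^(p/2) - 1, which is
    comparable to |u|^p up to an additive constant: with
    D(x, y) = psi(x + y) - psi x - psi'(x) y, independence and mean zero give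
    E psi(S_(n+1)) - E psi(S_n) = E D(S_n, a_n X_n), and 0 <= D <= 6 phi(y)
    always, while D >= phi(y) / 10 when |x| <= 1/20. The upper bound follows
    by summation; for the lower bound, E psi(S_n) is nondecreasing in n, so if
    the final value is small then |S_n| <= 1/20 with probability at least 1/2
    at every step.

    On the other hand Phi x = int_0^1 phi(x f^*(s)) ds, and splitting the
    integral at t shows that the right-hand side F of the proposition is
    1 / Phi^-1 up to constants: Phi x <= t implies F(t) <= 3 / x, and
    F(t) <= 1 / x implies Phi x <= 2 t. Comparing Phi with M is then done
    directly, through a = 1_{k < n} with 1/n close to t in one direction. *)

Set Implicit Arguments.
Unset Strict Implicit.
Unset Printing Implicit Defensive.

Import Order.TTheory GRing.Theory Num.Theory.
Import numFieldNormedType.Exports.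

Local Open Scope classical_set_scope.
Local Open Scope ring_scope.

(** * The functions phi and psi *)

Section scalar_inequalities.
Variable R : realType.
Implicit Types p q x y z : R.

(** Young's inequality for the product of [z^q] and 1, with conjugate exponents 1/q and 1/(1 -
    q). *)
Lemma powR_le_tangent1 q z : 0 < q <= 1 -> 0 <= z -> z `^ q <= 1 + q * (z - 1).
Proof.
move=> /andP[q0]; rewrite le_eqVlt => /predU1P[->|q1] z0.
  by rewrite powRr1//; lra.
have q1' : 0 < 1 - q by lra.
have := @conjugate_powR _ (z `^ q) 1 q^-1 (1 - q)^-1 (powR_ge0 _ _) ler01.
rewrite !invr_gt0 => /(_ q0 q1').
rewrite !invrK -powRrM mulfV ?gt_eqF// powRr1// powR1 mulr1.
by move=> /(_ _)/le_trans; apply; lra.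
Qed.

(** The concave case, applied to [z^q] with the exponent 1/q and solved for [z^q]. *)
Lemma powR_ge_tangent1 q z : 1 <= q -> 0 <= z -> 1 + q * (z - 1) <= z `^ q.
Proof.
move=> q1 z0; have q0 : 0 < q by lra.
have /powR_le_tangent1 : 0 < q^-1 <= 1 by rewrite invr_gt0 q0 invf_le1.
move=> /(_ _ (powR_ge0 z q)); rewrite -powRrM mulfV ?gt_eqF// powRr1// => h.
have : q * z <= q * (1 + q^-1 * (z `^ q - 1)) by rewrite ler_pM2l.
by rewrite mulrDr mulrA mulfV ?gt_eqF//; lra.
Qed.

Lemma powR_le_tangent q x y : 0 < q <= 1 -> 0 < x -> 0 <= y ->
  y `^ q <= x `^ q + q * x `^ (q - 1) * (y - x).
Proof.
move=> q01 x0 y0; have /andP[q0 _] := q01.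
have x0' := ltW x0.
have := powR_le_tangent1 q01 (divr_ge0 y0 x0').
rewrite -(ler_pM2l (powR_gt0 q x0)) -powRM ?divr_ge0//.
have -> : x * (y / x) = y by field; rewrite gt_eqF.
move/le_trans; apply; rewrite mulrDr mulr1 lerD2l.
have -> : x `^ (q - 1) = x `^ q / x.
  by rewrite powRB ?powRr1// (gt_eqF x0) implybT.
by rewrite le_eqVlt; apply/orP; left; apply/eqP; field; rewrite gt_eqF.
Qed.

(** The fractions x/(x + y) and y/(x + y) lie in [0, 1], so each is at most its own q-th power,
    while together they sum to 1. *)
Lemma subadditive_powR q x y : 0 < q <= 1 -> 0 <= x -> 0 <= y ->
  (x + y) `^ q <= x `^ q + y `^ q.
Proof.
move=> /andP[q0 q1]; rewrite le_eqVlt => /predU1P[<- y0|x0 y0].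
  by rewrite powR0 ?gt_eqF// !add0r.
have xy0 : 0 < x + y by lra.
have frac z : 0 <= z -> z <= x + y -> (x + y) `^ q * (z / (x + y)) <= z `^ q.
  rewrite le_eqVlt => /predU1P[<- _|z0 zxy].
    by rewrite mul0r mulr0 powR_ge0.
  rewrite -[leRHS](_ : (x + y) `^ q * (z / (x + y)) `^ q = _); last first.
    rewrite -powRM ?divr_ge0 ?(ltW z0) ?(ltW xy0)//; congr (_ `^ _).
    by field; rewrite gt_eqF.
  rewrite ler_pM2l ?powR_gt0//; apply: ger1_powR => //.
  by rewrite divr_gt0//= ler_pdivrMr// mul1r.
have hx : x <= x + y by lra.
have hy : y <= x + y by lra.
apply: le_trans (lerD (frac x (ltW x0) hx) (frac y y0 hy)).
by rewrite -mulrDr -mulrDl mulfV ?mulr1 ?gt_eqF.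
Qed.

(* phi of the header *)
Definition cutpow p x := Num.min (x ^+ 2) (`|x| `^ p).

(* psi of the header; jpow_slope is its derivative and bregman is D. *)
Definition jpow p x := (1 + x ^+ 2) `^ (p / 2) - 1.

Definition jpow_slope p x := p * x * (1 + x ^+ 2) `^ (p / 2 - 1).

Definition bregman p x y := jpow p (x + y) - jpow p x - jpow_slope p x * y.

Lemma cutpow_ge0 p x : 0 <= cutpow p x.
Proof. by rewrite le_min sqr_ge0 powR_ge0. Qed.

Lemma cutpow_norm p x : cutpow p `|x| = cutpow p x.
Proof. by rewrite /cutpow real_normK ?num_real// normr_id. Qed.

Lemma sqr_norm_powR p x : (x ^+ 2) `^ (p / 2) = `|x| `^ p.
Proof.
rewrite -(real_normK (num_real x)) -powR_mulrn// -powRrM; congr (_ `^ _).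
by field.
Qed.

Lemma half_exponent p : 1 <= p <= 2 -> 0 < p / 2 <= 1.
Proof. by move=> /andP[p1 p2]; apply/andP; split; lra. Qed.

Lemma base_gt0 x : 0 < 1 + x ^+ 2.
Proof. by have := sqr_ge0 x; lra. Qed.

Lemma base_ge1 x : 1 <= 1 + x ^+ 2.
Proof. by have := sqr_ge0 x; lra. Qed.

Lemma jpow_ge0 p x : 1 <= p <= 2 -> 0 <= jpow p x.
Proof.
move=> p12; have /andP[p1 p2] := p12; have /andP[q0 q1] := half_exponent p12.
have q01 : 0 < p / 2 <= 1 by apply/andP.
have q0' := ltW q0.
by rewrite subr_ge0 -[leLHS](powRr0 (1 + x ^+ 2)) ler_powR ?base_ge1//; lra.
Qed.

Lemma jpow0 p : jpow p 0 = 0.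
Proof. by rewrite /jpow expr0n/= addr0 powR1 subrr. Qed.

Lemma jpow_le_powR p x : 1 <= p <= 2 -> jpow p x <= `|x| `^ p.
Proof.
move=> p12; have /andP[p1 p2] := p12; have /andP[q0 q1] := half_exponent p12.
have q01 : 0 < p / 2 <= 1 by apply/andP.
have q0' := ltW q0.
rewrite lerBlDr [leRHS]addrC.
apply: le_trans (subadditive_powR q01 ler01 (sqr_ge0 x)) _.
by rewrite powR1 sqr_norm_powR.
Qed.

Lemma powR_le_jpow p x : 1 <= p <= 2 -> `|x| `^ p <= 1 + jpow p x.
Proof.
move=> p12; have /andP[p1 p2] := p12; have /andP[q0 q1] := half_exponent p12.
have q01 : 0 < p / 2 <= 1 by apply/andP.
have q0' := ltW q0.
rewrite /jpow addrCA subrr addr0 -sqr_norm_powR ge0_ler_powR ?nnegrE ?sqr_ge0//.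
- exact: ltW (base_gt0 _).
- by have := sqr_ge0 x; lra.
Qed.

(** The concave power p/2 lies below its tangent at 1 + x^2. The base moves by 2xy + y^2: the term
    2xy cancels against [jpow_slope], and y^2 keeps a coefficient at most 1. *)
Lemma bregman_sqr p x y : 1 <= p <= 2 -> bregman p x y <= y ^+ 2.
Proof.
move=> p12; have /andP[p1 p2] := p12; have /andP[q0 q1] := half_exponent p12.
have q01 : 0 < p / 2 <= 1 by apply/andP.
have q0' := ltW q0.
have := powR_le_tangent q01 (base_gt0 x) (ltW (base_gt0 (x + y))).
rewrite /bregman /jpow /jpow_slope.
set a := _ `^ (p / 2 - 1); set b := _ `^ (p / 2); set c := _ `^ (p / 2).
have a0 : 0 <= a by exact: powR_ge0.
have a1 : a <= 1.
  by rewrite /a -[leRHS](powRr0 (1 + x ^+ 2)) ler_powR ?base_ge1//; lra.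
have : p / 2 * (a * y ^+ 2) <= 1 * (1 * y ^+ 2).
  apply: ler_pM => //; first by rewrite mulr_ge0 ?sqr_ge0.
  by apply: ler_wpM2r => //; exact: sqr_ge0.
move=> h1 h2; lra.
Qed.

(** If y^2 <= 1 + x^2, the tangent bound still works, because the exponent p/2 - 1 is nonpositive.
    Otherwise y dominates x, and 6 = 4 + 2 collects the value at x + y and the slope term. *)
Lemma bregman_powR p x y : 1 <= p <= 2 -> bregman p x y <= 6 * `|y| `^ p.
Proof.
move=> p12; have /andP[p1 p2] := p12; have /andP[q0 q1] := half_exponent p12.
have q01 : 0 < p / 2 <= 1 by apply/andP.
have q0' := ltW q0.
have [yx|xy] := leP (y ^+ 2) (1 + x ^+ 2).
  have [->|y0] := eqVneq y 0.
    by rewrite /bregman addr0 mulr0 subr0 subrr mulr_ge0 ?powR_ge0.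
  have y20 : 0 < y ^+ 2 by rewrite exprn_even_gt0.
  have := powR_le_tangent q01 (base_gt0 x) (ltW (base_gt0 (x + y))).
  rewrite /bregman /jpow /jpow_slope -sqr_norm_powR.
  have : (1 + x ^+ 2) `^ (p / 2 - 1) * y ^+ 2 <= (y ^+ 2) `^ (p / 2).
    rewrite -[leRHS](@mulr_powRB1 _ (y ^+ 2) (p / 2)) ?sqr_ge0//.
    rewrite mulrC ler_pM2l//.
    rewrite -(opprB 1 (p / 2)) !powRN lef_pV2 ?posrE ?powR_gt0 ?base_gt0//.
    by rewrite ge0_ler_powR ?nnegrE ?(ltW (base_gt0 _))//; lra.
  set a := (1 + x ^+ 2) `^ (p / 2 - 1); set b := _ `^ (p / 2).
  set c := _ `^ (p / 2); set d := _ `^ (p / 2) => h.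
  have b0 : 0 <= b by exact: powR_ge0.
  have : p / 2 * (a * y ^+ 2) <= 1 * b.
    by apply: ler_pM => //; rewrite mulr_ge0 ?sqr_ge0 ?powR_ge0.
  by move=> h1 h2; lra.
have y0 : 0 < `|y|.
  rewrite normr_gt0; apply/eqP => y0; move: xy; rewrite y0 expr0n/= ltNge.
  by rewrite (ltW (base_gt0 _)).
have y1 : 0 < y ^+ 2 by exact: lt_trans (base_gt0 x) xy.
have xny : `|x| <= `|y|.
  by rewrite -(@ler_pXn2r _ 2) ?nnegrE// !real_normK ?num_real//; lra.
have slope : `|jpow_slope p x * y| <= 2 * `|y| `^ p.
  rewrite /jpow_slope !normrM (ger0_norm (powR_ge0 _ _)) (ger0_norm (_ : 0 <= p)); last lra.
  rewrite -!mulrA ler_pM//; [lra|by rewrite !mulr_ge0 ?powR_ge0|].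
  rewrite -(@mulr_powRB1 _ `|y| p)//; last lra.
  rewrite mulrA mulrC ler_pM2l//.
  (* One half of the exponent is split off to absorb |x|, since |x| <= (1 + x^2)^(1/2); what is left
     is at most |y|^(p - 1). *)
  have -> : (1 + x ^+ 2) `^ (p / 2 - 1) =
      (1 + x ^+ 2) `^ ((p - 1) / 2) * (1 + x ^+ 2) `^ (- 2^-1).
    rewrite -powRD; last by rewrite (gt_eqF (base_gt0 x)) implybT.
    by congr (_ `^ _); field.
  rewrite mulrCA -[leRHS]mulr1 ler_pM ?powR_ge0 ?mulr_ge0 ?powR_ge0//.
    rewrite -sqr_norm_powR ge0_ler_powR ?nnegrE ?(ltW (base_gt0 _))//; lra.
  rewrite powRN ler_pdivrMr ?powR_gt0 ?base_gt0// mul1r powR12_sqrt ?(ltW (base_gt0 _))//.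
  by rewrite -sqrtr_sqr ler_wsqrtr//; lra.
have : (1 + (x + y) ^+ 2) `^ (p / 2) <= 4 * `|y| `^ p.
  have -> : 4 * `|y| `^ p = 4 * (y ^+ 2) `^ (p / 2) by rewrite sqr_norm_powR.
  apply: (@le_trans _ _ ((4 * y ^+ 2) `^ (p / 2))).
    have y4 : 0 <= 4 * y ^+ 2 by rewrite mulr_ge0 ?(ltW y1).
    rewrite ge0_ler_powR ?nnegrE ?(ltW (base_gt0 _))//.
    by have := sqr_ge0 (x - y); nra.
  rewrite powRM ?(ltW y1)// ler_pM2r ?powR_gt0//.
  by apply: ler1_powR; lra.
have : 1 <= (1 + x ^+ 2) `^ (p / 2).
  by rewrite -[leLHS](powRr0 (1 + x ^+ 2)) ler_powR ?base_ge1//; lra.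
have := slope; rewrite ler_norml => /andP[+ _].
rewrite /bregman {1}/jpow /jpow_slope /jpow.
by move: (_ * y) (_ `^ (p/2)) (_ `^ (p/2)) => u v w; lra.
Qed.

Lemma bregman_le_cutpow p x y : 1 <= p <= 2 -> bregman p x y <= 6 * cutpow p y.
Proof.
move=> p12; have /andP[p1 p2] := p12; have /andP[q0 q1] := half_exponent p12.
have q01 : 0 < p / 2 <= 1 by apply/andP.
have q0' := ltW q0.
rewrite /cutpow; case: (leP (y ^+ 2) (`|y| `^ p)) => _; last exact: bregman_powR.
apply: le_trans (bregman_sqr x y p12) _; have := sqr_ge0 y; lra.
Qed.


(* With [s = sqrt (B / A)], the tangent inequality [s^p >= 1 + p (s - 1)]
   reduces the estimate to the exponent 1, where it is an identity. *)
Lemma bregman_ge_sqrt p x y (A := 1 + x ^+ 2) (B := 1 + (x + y) ^+ 2)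
    (s := Num.sqrt (B / A)) (w := 1 + x * y / A) : 1 <= p <= 2 ->
  [/\ 0 <= s - w, (s - w) * (s + w) = y ^+ 2 / A ^+ 2 & s - w <= bregman p x y].
Proof.
move=> p12; have /andP[p1 p2] := p12; have /andP[q0 q1] := half_exponent p12.
have A0 : 0 < A by exact: base_gt0.
have B0 : 0 < B by exact: base_gt0.
have BA0 : 0 <= B / A by rewrite divr_ge0 ?(ltW A0) ?(ltW B0).
have s2 : s ^+ 2 = B / A by rewrite sqr_sqrtr.
have A0' : A != 0 by rewrite gt_eqF.
have sw : (s - w) * (s + w) = y ^+ 2 / A ^+ 2.
  rewrite -subr_sqr s2 /w; move: A0'; rewrite /A /B => A0'.
  by field.
have s0 : 0 <= s by exact: sqrtr_ge0.
have sw0 : 0 <= s - w.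
  (* If s < w, then s + w > 0 because s >= 0, and the product would be negative, although it equals
     the square quotient in [sw]. *)
  rewrite leNgt; apply/negP => sw'.
  have : (s - w) * (s + w) < 0 by rewrite nmulr_rlt0//; lra.
  by rewrite sw ltNge divr_ge0 ?sqr_ge0.
split => //.
have sp : B `^ (p / 2) = A `^ (p / 2) * s `^ p.
  rewrite /s -powR12_sqrt// -powRrM mulrC -powRM ?(ltW A0)//; last first.
  by congr (_ `^ _); field.
have -> : bregman p x y = A `^ (p / 2) * (s `^ p - 1 - p * (x * y / A)).
  rewrite /bregman /jpow /jpow_slope -/A -/B sp.
  have -> : A `^ (p / 2 - 1) = A `^ (p / 2) / A.
    by rewrite powRB ?powRr1 ?(ltW A0)// A0' implybT.
  by field.
have h : s - w <= s `^ p - 1 - p * (x * y / A).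
  have := powR_ge_tangent1 p1 s0.
  have : 0 <= (p - 1) * (s - w) by rewrite mulr_ge0//; lra.
  by rewrite /w; lra.
have A1 : 1 <= A `^ (p / 2).
  by rewrite -[leLHS](powRr0 A) ler_powR ?base_ge1//; lra.
rewrite -[leLHS]mul1r; apply: ler_pM => //; lra.
Qed.

(** Dividing (s - w)(s + w) = y^2 / A^2 by s + w <= 4 and using A^2 <= 2 gives s - w >= y^2 / 8. *)
Lemma bregman_ge_near p x y : 1 <= p <= 2 -> `|x| <= 20^-1 -> `|y| <= 1 ->
  y ^+ 2 / 10 <= bregman p x y.
Proof.
move=> p12 /ler_normlP[x1 x2] /ler_normlP[y1 y2].
have [] := bregman_ge_sqrt x y p12.
set A := 1 + x ^+ 2; set B := 1 + (x + y) ^+ 2; set s := Num.sqrt _.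
set w := 1 + _ => sw0 sw; apply: le_trans.
have A1 : 1 <= A by exact: base_ge1.
have A0 : 0 < A by lra.
have A2 : A <= 401 / 400 by rewrite /A; nra.
have s2 : s <= 2.
  rewrite -(@ler_pXn2r _ 2) ?nnegrE ?sqrtr_ge0// sqr_sqrtr; last first.
    by rewrite divr_ge0 ?(ltW A0) ?(ltW (base_gt0 _)).
  by rewrite ler_pdivrMr// /B; nra.
have : y ^+ 2 / A ^+ 2 * A ^+ 2 = y ^+ 2 by field; rewrite gt_eqF.
rewrite -sw => <-.
have A3 : A ^+ 2 <= 2 by nra.
have h1 : (s - w) * (s + w) <= (s - w) * 4 by rewrite ler_wpM2l//; lra.
have h0 : 0 <= (s - w) * (s + w) by rewrite sw divr_ge0 ?sqr_ge0.
have : (s - w) * (s + w) * A ^+ 2 <= (s - w) * 4 * 2.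
  by rewrite ler_pM ?sqr_ge0.
by move=> h; lra.
Qed.

(** The value at x + y exceeds the value at x by at least a quarter of [B^(p/2)], hence by
    (9/40)|y|^p, and the slope term costs at most |y|^p / 10. *)
Lemma bregman_ge_far p x y : 1 <= p <= 2 -> `|x| <= 20^-1 -> 1 <= `|y| ->
  `|y| `^ p / 10 <= bregman p x y.
Proof.
move=> p12 x1 y1.
have /andP[p1 p2] := p12; have /andP[q0 q1] := half_exponent p12.
have q0' := ltW q0.
rewrite /bregman /jpow /jpow_slope.
set A := 1 + x ^+ 2; set B := 1 + (x + y) ^+ 2.
have A1 : 1 <= A by exact: base_ge1.
have A0 : 0 <= A by lra.
have B0 : 0 <= B by exact: (ltW (base_gt0 _)).
have A2 : A <= 401 / 400.
  by have /ler_normlP[? ?] := x1; rewrite /A; nra.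
have B2 : 9 / 10 * y ^+ 2 <= B - 1.
  have : (`|y| - `|x|) ^+ 2 <= (x + y) ^+ 2.
    have xy0 : 0 <= `|y| - `|x| by lra.
    rewrite -[leRHS]real_normK ?num_real// ler_pXn2r ?nnegrE//.
    by rewrite [x + y]addrC; have := lerB_dist y (- x); rewrite normrN opprK.
  rewrite -[y ^+ 2]real_normK ?num_real// /B => h.
  by move: h x1 y1 (normr_ge0 x); move: `|y| `|x| => a b; nra.
have y2 : 1 <= y ^+ 2 by rewrite -[y ^+ 2]real_normK ?num_real//; nra.
have BA : A `^ (p / 2) <= 3 / 4 * B `^ (p / 2).
  (* Here A <= 401/400 and B >= 19/10, so A <= (9/16) B; since p/2 >= 1/2, the factor 9/16 becomes
     at most its square root 3/4. *)
  apply: (@le_trans _ _ ((9 / 16 * B) `^ (p / 2))).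
    rewrite ge0_ler_powR ?nnegrE//; lra.
  rewrite powRM//.
  rewrite ler_wpM2r ?powR_ge0//.
  have -> : 3 / 4 = (9 / 16 : R) `^ 2^-1.
    rewrite powR12_sqrt; last lra.
    have -> : 9 / 16 = (3 / 4 : R) ^+ 2 by field.
    by rewrite sqrtr_sqr ger0_norm//; lra.
  apply: ger_powR; [apply/andP; split|]; lra.
have By : 9 / 10 * `|y| `^ p <= B `^ (p / 2).
  apply: (@le_trans _ _ ((9 / 10 * y ^+ 2) `^ (p / 2))).
    rewrite powRM ?sqr_ge0//.
    rewrite sqr_norm_powR ler_wpM2r ?powR_ge0//.
    apply: ger1_powR => //; apply/andP; split; lra.
  by rewrite ge0_ler_powR ?nnegrE//; lra.
have slope : `|p * x * A `^ (p / 2 - 1) * y| <= 1 / 10 * `|y| `^ p.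
  rewrite !normrM (ger0_norm (powR_ge0 _ _)) (@ger0_norm _ p); last lra.
  have a1 : A `^ (p / 2 - 1) <= 1.
    by rewrite -[leRHS](powRr0 A) ler_powR//; lra.
  have h1 : p * `|x| <= 1 / 10 by have := normr_ge0 x; nra.
  have h2 : p * `|x| * A `^ (p / 2 - 1) <= 1 / 10 * 1.
    by rewrite ler_pM ?powR_ge0// mulr_ge0//; lra.
  rewrite mulr1 in h2.
  rewrite ler_pM//; first by rewrite mulr_ge0 ?powR_ge0// mulr_ge0//; lra.
  exact: le1r_powR.
have := powR_ge0 `|y| p; move: slope; rewrite ler_norml => /andP[_]; lra.
Qed.

Lemma bregman_ge0 p x y : 1 <= p <= 2 -> 0 <= bregman p x y.
Proof. by move=> p12; have [h _] := bregman_ge_sqrt x y p12; exact: le_trans. Qed.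

(** The worst exponent is p = 1, where the bound is sqrt(1 + 1/400) >= 1 + 1/1000. *)
Lemma jpow_gt_thousandth p x : 1 <= p <= 2 -> 20^-1 <= `|x| ->
  1 / 1000 <= jpow p x.
Proof.
move=> p12 x20; have /andP[p1 p2] := p12.
rewrite lerBrDr; apply: (@le_trans _ _ ((1 + x ^+ 2) `^ 2^-1)); last first.
  by rewrite ler_powR ?base_ge1//; lra.
rewrite powR12_sqrt ?(ltW (base_gt0 _))//.
rewrite -[leLHS](@ger0_norm R); last lra.
rewrite -sqrtr_sqr ler_wsqrtr//.
by rewrite -[x ^+ 2]real_normK ?num_real//; nra.
Qed.

(* The lower bound for |x| <= 1/20, in a form valid for all x: the left-hand
   side is nonpositive as soon as jpow p x >= 1/1000. *)
Lemma cutpow_le_bregman p x y : 1 <= p <= 2 ->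
  cutpow p y / 10 * (1 - 1000 * jpow p x) <= bregman p x y.
Proof.
move=> p12; have c0 := cutpow_ge0 p y.
have [x20|x20] := leP `|x| 20^-1; last first.
  apply: le_trans (bregman_ge0 x y p12).
  apply: mulr_ge0_le0; first lra.
  have := jpow_gt_thousandth p12 (ltW x20); lra.
have j0 := jpow_ge0 x p12.
apply: (@le_trans _ _ (cutpow p y / 10)).
  by apply: ler_piMr; lra.
have [y1|y1] := leP `|y| 1.
  apply: le_trans (bregman_ge_near p12 x20 y1).
  by rewrite ler_pM2r ?invr_gt0// ge_min lexx.
apply: le_trans (bregman_ge_far p12 x20 (ltW y1)).
by rewrite ler_pM2r ?invr_gt0// ge_min lexx orbT.
Qed.

(** For p < 2 the slope of phi drops at 1, so phi is not convex; this scaling, from l^2 <= l and l^p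
    <= l, stands in for convexity. *)
Lemma cutpow_scale_le1 p l x : 1 <= p <= 2 -> 0 <= l <= 1 ->
  cutpow p (l * x) <= l * cutpow p x.
Proof.
move=> p12 /andP[]; have /andP[p1 p2] := p12.
rewrite le_eqVlt => /predU1P[<- _|l0 l1].
  rewrite !mul0r /cutpow normr0 powR0 ?expr0n/= ?ge_min ?lexx//.
  by rewrite gt_eqF//; lra.
rewrite /cutpow minr_pMr ?(ltW l0)// le_min !ge_min; apply/andP; split.
  by rewrite exprMn ler_wpM2r ?sqr_ge0// expr2 ler_piMr// ltW.
apply/orP; right; rewrite normrM powRM// ler_wpM2r ?powR_ge0//.
by rewrite (gtr0_norm l0) ge1r_powR// l0.
Qed.

End scalar_inequalities.

(** * Independence of partial sums *)

Section product_laws.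
Context d1 d2 (T1 : measurableType d1) (T2 : measurableType d2) (R : realType).
Local Open Scope ereal_scope.

(** Rectangles form a generating pi-system that contains the whole space, and the total mass is
    finite. *)
Lemma measure_unique_setX (m1 m2 : {measure set (T1 * T2) -> \bar R}) :
  (forall A B, measurable A -> measurable B -> m1 (A `*` B) = m2 (A `*` B)) ->
  m1 setT < +oo ->
  forall C, measurable C -> m1 C = m2 C.
Proof.
move=> m12 m1oo C mC.
pose G := [set A `*` B | A in @measurable _ T1 & B in @measurable _ T2].
apply: (measure_unique G (fun=> setT)) => //.
- exact: measurable_prod_measurableType.
- move=> _ _ [A1 mA1 [B1 mB1 <-]] [A2 mA2 [B2 mB2 <-]].
  rewrite -setXI; exists (A1 `&` A2); first exact: measurableI.
  by exists (B1 `&` B2) => //; exact: measurableI.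
- by move=> _; exists setT => //; exists setT => //; rewrite setXTT.
- by rewrite bigcup_const//; exists 0%N.
- by move=> _ [A mA [B mB <-]]; exact: m12.
Qed.

End product_laws.

Section integral_of_law.
Context d (T : measurableType d) (R : realType).
Local Open Scope ereal_scope.

(** Change of variables for a function measurable on D only: g is extended by 0, m is restricted to
    D, and the pushforward formula applies. It serves both f on [0, 1] and its rearrangement on ]0,
    1]. *)
Lemma ge0_integral_law (m : {measure set T -> \bar R}) (D : set T) (g : T -> R)
    (nu : {measure set R -> \bar R}) (h : R -> \bar R) :
  measurable D -> measurable_fun D g ->
  (forall B, measurable B -> m (D `&` g @^-1` B) = nu B) ->
  measurable_fun setT h -> (forall y, 0 <= h y) ->
  \int[m]_(x in D) h (g x) = \int[nu]_y h y.
Proof.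
move=> mD mg mnu mh h0.
pose g0 := g \_ D.
have mg0 : measurable_fun setT g0 by exact/(measurable_restrictT _ _).1.
have g0E x : D x -> g0 x = g x by move=> Dx; rewrite /g0 patchE mem_set.
have -> : \int[m]_(x in D) h (g x) = \int[mrestr m mD]_(x in D) h (g0 x).
  rewrite (eq_measure_integral (mrestr m mD)); last first.
    by move=> A mA AD; rewrite /= /mrestr setIidl.
  by apply: eq_integral => x; rewrite inE => /g0E ->.
have mhg : measurable_fun setT (h \o g0) by exact: measurableT_comp.
have -> : \int[mrestr m mD]_(x in D) h (g0 x) = \int[mrestr m mD]_x h (g0 x).
  rewrite -(setvU D) ge0_integral_setU//=; first last.
  - by apply/disj_setPS => x [].
  - by rewrite setvU.
  - exact: measurableC.
  rewrite [X in _ = X + _](_ : _ = 0) ?add0e//.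
  rewrite (eq_measure_integral mzero) ?integral_measure_zero// => A mA AD.
  rewrite /= /mzero /mrestr (_ : A `&` D = set0) ?measure0//.
  by apply/disjoints_subset.
rewrite -(@ge0_integral_pushforward _ _ _ _ _ g0 mg0 (mrestr m mD) setT h)//.
apply: eq_measure_integral => A mA _.
rewrite /pushforward /= /mrestr -mnu// setIC; congr (m _).
by apply/seteqP; split => x /= [+ Dx]; rewrite g0E.
Qed.

End integral_of_law.

Section independence.
Context d (T : measurableType d) (R : realType) (P : probability T R).
Local Open Scope ereal_scope.

(** The joint law agrees with the product of the marginals on rectangles, hence is that product;
    Tonelli's theorem then integrates out the second variable. *)
Lemma ge0_integral_indep (S X : {RV P >-> R}) (h : R * R -> \bar R) :
  (forall A B, measurable A -> measurable B ->
     P (S @^-1` A `&` X @^-1` B) = P (S @^-1` A) * P (X @^-1` B)) ->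
  measurable_fun setT h -> (forall z, 0 <= h z) ->
  \int[P]_w h (S w, X w) = \int[P]_w \int[distribution P X]_y h (S w, y).
Proof.
move=> indSX mh h0.
have mSX : measurable_fun setT (fun w => (S w, X w)).
  exact: measurable_fun_pair.
rewrite -(@ge0_integral_pushforward _ _ _ _ _ _ mSX P setT h)//.
rewrite (eq_measure_integral (distribution P S \x distribution P X)); last first.
  by move=> A mA _; apply/esym/product_measure_unique => // B C mB mC;
     rewrite /= /pushforward/= -indSX.
rewrite fubini_tonelli1// ge0_integral_distribution//.
- exact: measurable_fun_fubini_tonelli_F.
- by move=> x; exact: integral_ge0.
Qed.

Variables (X : nat -> {RV P >-> R}) (a : nat -> R).

Definition lincomb n w := (\sum_(k < n) a k * X k w)%R.

Lemma measurable_lincomb n : measurable_fun setT (lincomb n).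
Proof. by apply: measurable_sum => k; exact: measurable_funM. Qed.

HB.instance Definition _ n :=
  isMeasurableFun.Build _ _ _ _ (lincomb n) (measurable_lincomb n).

Lemma lincombS n w : (lincomb n.+1 w = lincomb n w + a n * X n w)%R.
Proof. by rewrite /lincomb big_ord_recr. Qed.

Let cylinder (J : seq nat) (B : nat -> set R) :=
  [set w | forall k, k \in J -> B k (X k w)].

Let measurable_cylinder J B :
  (forall k, measurable (B k)) -> measurable (cylinder J B).
Proof.
move=> mB; rewrite (_ : cylinder J B = \big[setI/setT]_(k <- J) (X k @^-1` B k)).
  by apply: bigsetI_measurable => k _; exact: measurable_funPTI.
by rewrite -bigcap_seq; apply/seteqP; split.
Qed.

(* The cylinder over later indices is carried along so that the induction on n
   only ever compares two measures on R * R that agree on rectangles. *)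
Lemma lincomb_indep n J B A : mutually_independent X ->
  uniq J -> (forall k, k \in J -> (n <= k)%N) ->
  (forall k, measurable (B k)) -> measurable A ->
  P (lincomb n @^-1` A `&` [set w | forall k, k \in J -> B k (X k w)]) =
  P (lincomb n @^-1` A) * P [set w | forall k, k \in J -> B k (X k w)].
Proof.
move=> indX; elim: n J B A => [|n IH] J B A uJ nJ mB mA.
  have -> : lincomb 0 @^-1` A = [set w | A 0%R].
    by apply/seteqP; split => w; rewrite /= /lincomb big_ord0.
  have [A0|A0] := pselect (A 0%R).
    have -> : [set w : T | A 0%R] = setT by apply/seteqP; split.
    by rewrite setTI probability_setT mul1e.
  have -> : [set w : T | A 0%R] = set0 by apply/seteqP; split.
  by rewrite set0I measure0 mul0e.
set E := cylinder J B.
have mE : measurable E by exact: measurable_cylinder.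
have PE0 : (0 <= fine (P E))%R by exact: fine_ge0.
pose C := [set z : R * R | A (z.1 + a n * z.2)%R].
have mC : measurable C.
  rewrite -[C]setTI; apply: (_ : measurable_fun setT _) => //.
  by apply: measurable_funD => //; exact: measurable_funM.
pose SX w := (lincomb n w, X n w).
have mSX : measurable_fun setT SX by exact: measurable_fun_pair.
have preC : lincomb n.+1 @^-1` A = SX @^-1` C.
  by apply/seteqP; split => w; rewrite /C/= lincombS.
have nJn k : k \in J -> k != n.
  by move=> /nJ; rewrite ltnNge; apply: contraNneq => ->.
(* The two measures compared are the law of (S_n, X_n) restricted to E, and P(E) times its full law;
   their values on [C] are the two sides of the goal. *)
have := @measure_unique_setX _ _ _ _ R (pushforward (mrestr P mE) SX)
  (mscale (NngNum PE0) (pushforward P SX)).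
move=> /(_ mSX mSX _ _ C mC); rewrite /= /mscale /= /pushforward /mrestr/= -preC.
rewrite fineK ?fin_num_measure// [RHS]muleC; apply; last first.
  by rewrite preimage_setT setTI ltey_eq fin_num_measure.
move=> A' B' mA' mB'.
have preX : SX @^-1` (A' `*` B') =
    lincomb n @^-1` A' `&` X n @^-1` B' by [].
(* Overwriting the entry at n turns the event X_n in B' together with E into one cylinder over
   [n :: J]. The induction hypothesis is then used for [n :: J] and for [[:: n]]. *)
pose B1 k := if k == n then B' else B k.
have mB1 k : measurable (B1 k) by rewrite /B1; case: ifP.
have cylB1 : cylinder (n :: J) B1 = X n @^-1` B' `&` E.
  apply/seteqP; split => w /=.
    move=> h; split; first by have := h n (mem_head _ _); rewrite /B1 eqxx.
    move=> k kJ; have := h k; rewrite inE kJ orbT => /(_ isT).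
    by rewrite /B1 (negbTE (nJn _ kJ)).
  move=> [h1 h2] k; rewrite inE => /predU1P[->|kJ].
    by rewrite /B1 eqxx.
  by rewrite /B1 (negbTE (nJn _ kJ)); exact: h2.
have cyl1 : cylinder [:: n] B1 = X n @^-1` B'.
  apply/seteqP; split => w /=.
    by move=> /(_ n (mem_head _ _)); rewrite /B1 eqxx.
  by move=> h k; rewrite inE => /eqP ->; rewrite /B1 eqxx.
have unJ : uniq (n :: J).
  by rewrite /= uJ andbT; apply/negP => /nJn; rewrite eqxx.
have nle k : k \in n :: J -> (n <= k)%N.
  by rewrite inE => /predU1P[->//|/nJ/ltnW].
have PnJ : P (cylinder (n :: J) B1) = P (X n @^-1` B') * P E.
  rewrite indX// big_cons /B1 eqxx; congr (_ * _).
  rewrite -[RHS]/(P [set w | _]) indX//; apply: eq_big_seq => k kJ.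
  by rewrite (negbTE (nJn _ kJ)).
rewrite preX -setIA -cylB1 IH// PnJ.
rewrite -cyl1 IH//; last by move=> k; rewrite inE => /eqP ->.
by rewrite -/(cylinder [:: n] B1) muleA muleC.
Qed.

Lemma lincomb_indep1 n A B : mutually_independent X ->
  measurable A -> measurable B ->
  P (lincomb n @^-1` A `&` X n @^-1` B) =
  P (lincomb n @^-1` A) * P (X n @^-1` B).
Proof.
move=> indX mA mB; have := @lincomb_indep n [:: n] (fun=> B) A indX.
rewrite (_ : [set w | _] = X n @^-1` B); last first.
  apply/seteqP; split => w /=; first by move=> /(_ n (mem_head _ _)).
  by move=> h k; rewrite inE => /eqP ->.
by apply => // k; rewrite inE => /eqP ->.
Qed.

End independence.

(** * Moments of linear combinations *)

Lemma integral_probability_cst d (T : measurableType d) (R : realType)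
  (P : probability T R) (c : R) : (\int[P]_w c%:E = c%:E)%E.
Proof.
by rewrite integral_cst//= probability_setT mule1.
Qed.

Section cut_moment.
Variable R : realType.
Implicit Types p x a : R.

Lemma measurable_norm_powR p : measurable_fun setT (fun y : R => `|y| `^ p).
Proof.
by apply: (measurableT_comp (measurable_powR p)).
Qed.

Lemma measurable_cutpow p : measurable_fun setT (@cutpow R p).
Proof.
apply: measurable_minr; last exact: measurable_norm_powR.
exact: measurable_funX.
Qed.

Lemma measurable_jpow p : measurable_fun setT (@jpow R p).
Proof.
apply: measurable_funB => //; apply: (measurableT_comp (measurable_powR _)).
by apply: measurable_funD => //; exact: measurable_funX.
Qed.

Variable nu : probability R R.

(* Phi of the header *)
Definition cut_moment p x : R :=
  fine (\int[nu]_y (cutpow p (x * y))%:E)%E.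

Lemma measurable_cutpowM p x :
  measurable_fun setT (fun y => (cutpow p (x * y))%:E).
Proof.
apply/measurable_EFinP; apply: (measurableT_comp (measurable_cutpow p)).
exact: measurable_funM.
Qed.

Variable p : R.
Hypothesis p12 : 1 <= p <= 2.
Hypothesis nup : (\int[nu]_y (`|y| `^ p)%:E < +oo)%E.

(** The bound phi(xy) <= |x|^p |y|^p makes the integral finite, so [fine] loses nothing. *)
Lemma cut_momentE x : (\int[nu]_y (cutpow p (x * y))%:E)%E = (cut_moment p x)%:E.
Proof.
rewrite fineK// ge0_fin_numE; last first.
  by apply: integral_ge0 => y _; rewrite lee_fin cutpow_ge0.
apply: (@le_lt_trans _ _ (\int[nu]_y ((`|x| `^ p)%:E * (`|y| `^ p)%:E))%E).
  apply: ge0_le_integral => //.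
  - by move=> y _; rewrite lee_fin cutpow_ge0.
  - exact: measurable_cutpowM.
  - apply: measurable_funeM; apply/measurable_EFinP.
    exact: measurable_norm_powR.
  - by move=> y _; rewrite -EFinM lee_fin -powRM// -normrM ge_min lexx orbT.
rewrite ge0_integralZl//.
- by rewrite lte_mul_pinfty// lee_fin powR_ge0.
- by apply/measurable_EFinP; exact: measurable_norm_powR.
Qed.

Lemma cut_moment_ge0 x : 0 <= cut_moment p x.
Proof.
by rewrite -lee_fin -cut_momentE integral_ge0// => y _; rewrite lee_fin cutpow_ge0.
Qed.

Lemma cut_moment_norm x : cut_moment p `|x| = cut_moment p x.
Proof.
rewrite /cut_moment; congr fine; apply: eq_integral => y _.
by rewrite -(cutpow_norm _ (x * y)) -(cutpow_norm _ (`|x| * y)) !normrM normr_id.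
Qed.

Lemma cut_moment_scale l x : 0 <= l <= 1 ->
  cut_moment p (l * x) <= l * cut_moment p x.
Proof.
move=> l01; have /andP[l0 l1] := l01.
rewrite -lee_fin EFinM -!cut_momentE -ge0_integralZl//.
- apply: ge0_le_integral => //.
  + by move=> y _; rewrite lee_fin cutpow_ge0.
  + exact: measurable_cutpowM.
  + by apply: measurable_funeM; exact: measurable_cutpowM.
  + by move=> y _; rewrite -EFinM lee_fin -mulrA cutpow_scale_le1.
- exact: measurable_cutpowM.
- by move=> y _; rewrite lee_fin cutpow_ge0.
Qed.

Hypothesis nu0 : (\int[nu]_y y%:E = 0)%E.

Let integrable_id : nu.-integrable setT (fun y : R => y%:E).
Proof.
apply: (@le_integrable _ _ _ nu setT _ _ (fun y => (1 + `|y| `^ p)%:E)) => //.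
- by apply/measurable_EFinP.
- move=> y _; rewrite !abse_EFin lee_fin (ger0_norm (_ : 0 <= 1 + _)); last first.
    by rewrite addr_ge0 ?powR_ge0.
  have [y1|/ltW y1] := leP `|y| 1; first by rewrite ler_wpDr ?powR_ge0.
  by rewrite ler_wpDl// le1r_powR//; case/andP: p12.
- under eq_fun do rewrite EFinD.
  apply: integrableD => //; first exact: finite_measure_integrable_cst.
  apply/integrableP; split.
    by apply/measurable_EFinP; exact: measurable_norm_powR.
  by under eq_integral do rewrite abse_EFin ger0_norm ?powR_ge0//.
Qed.

Let measurable_jpow_shift x a :
  measurable_fun setT (fun y => jpow p (x + a * y)).
Proof.
apply: (measurableT_comp (measurable_jpow p)).
by apply: measurable_funD => //; exact: measurable_funM.
Qed.

Let measurable_bregmanM x a :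
  measurable_fun setT (fun y => bregman p x (a * y)).
Proof.
rewrite /bregman; apply: measurable_funB; last first.
  by apply: measurable_funM => //; exact: measurable_funM.
exact: measurable_funB.
Qed.

(** The remainder D is integrable since it is at most 6 phi, and the first-order term integrates to
    0 by mean zero. *)
Lemma integral_jpow_shift x a :
  (\int[nu]_y (jpow p (x + a * y))%:E =
   (jpow p x)%:E + \int[nu]_y (bregman p x (a * y))%:E)%E.
Proof.
have mb := measurable_bregmanM x a.
have intb : nu.-integrable setT (fun y => (bregman p x (a * y))%:E).
  apply/integrableP; split; first exact/measurable_EFinP.
  apply: (@le_lt_trans _ _ (\int[nu]_y (6%:E * (cutpow p (a * y))%:E))%E).
    apply: ge0_le_integral => //.
    - by apply/measurable_EFinP; exact: measurableT_comp.
    - by apply: measurable_funeM; exact: measurable_cutpowM.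
    - move=> y _; rewrite abse_EFin ger0_norm ?bregman_ge0//.
      by rewrite -EFinM lee_fin bregman_le_cutpow.
  rewrite ge0_integralZl//.
  - by rewrite cut_momentE -EFinM ltry.
  - exact: measurable_cutpowM.
  - by move=> y _; rewrite lee_fin cutpow_ge0.
transitivity (\int[nu]_y ((jpow p x)%:E +
    ((jpow_slope p x * a)%:E * y%:E + (bregman p x (a * y))%:E)))%E.
  apply: eq_integral => y _; rewrite -!EFinM -!EFinD; congr _%:E.
  by rewrite /bregman; ring.
rewrite integralD//=; first last.
- by apply: integrableD => //; exact: integrableZl.
- exact: finite_measure_integrable_cst.
rewrite integral_probability_cst integralD//; last exact: integrableZl.
by rewrite integralZl// nu0 mule0 add0e.
Qed.

Lemma integral_jpow_shift_le x a :
  (\int[nu]_y (jpow p (x + a * y))%:E <=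
   (jpow p x)%:E + (6 * cut_moment p a)%:E)%E.
Proof.
rewrite integral_jpow_shift leeD2l// EFinM -cut_momentE -ge0_integralZl//.
- apply: ge0_le_integral => //.
  + by move=> y _; rewrite lee_fin bregman_ge0.
  + by apply/measurable_EFinP; exact: measurable_bregmanM.
  + by apply: measurable_funeM; exact: measurable_cutpowM.
  + by move=> y _; rewrite -EFinM lee_fin bregman_le_cutpow.
- exact: measurable_cutpowM.
- by move=> y _; rewrite lee_fin cutpow_ge0.
Qed.

Lemma integral_jpow_shift_ge x a :
  ((jpow p x)%:E <= \int[nu]_y (jpow p (x + a * y))%:E)%E.
Proof.
rewrite integral_jpow_shift leeDl// integral_ge0// => y _.
by rewrite lee_fin bregman_ge0.
Qed.

(** Integrated form of [cutpow_le_bregman], with 100 = 1000/10. The negative term is moved to the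
    right so that no extended reals are subtracted. *)
Lemma integral_jpow_shift_growth x a :
  ((jpow p x)%:E + (cut_moment p a / 10)%:E <=
   \int[nu]_y (jpow p (x + a * y))%:E +
   (100 * cut_moment p a)%:E * (jpow p x)%:E)%E.
Proof.
rewrite integral_jpow_shift -addeA leeD2l//.
have j0 : 0 <= 100 * jpow p x by rewrite mulr_ge0 ?jpow_ge0.
have -> : ((100 * cut_moment p a)%:E * (jpow p x)%:E =
    \int[nu]_y ((100 * jpow p x)%:E * (cutpow p (a * y))%:E))%E.
  rewrite ge0_integralZl//.
  - by rewrite cut_momentE -!EFinM; congr _%:E; ring.
  - exact: measurable_cutpowM.
  - by move=> y _; rewrite lee_fin cutpow_ge0.
have -> : ((cut_moment p a / 10)%:E =
    \int[nu]_y (10^-1%:E * (cutpow p (a * y))%:E))%E.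
  rewrite ge0_integralZl//.
  - by rewrite cut_momentE -!EFinM mulrC.
  - exact: measurable_cutpowM.
  - by move=> y _; rewrite lee_fin cutpow_ge0.
rewrite -ge0_integralD//.
- apply: ge0_le_integral => //.
  + by move=> y _; rewrite -EFinM lee_fin mulr_ge0// cutpow_ge0.
  + by apply: measurable_funeM; exact: measurable_cutpowM.
  + apply: emeasurable_funD; first exact/measurable_EFinP.
    by apply: measurable_funeM; exact: measurable_cutpowM.
  + move=> y _; rewrite -!EFinM -EFinD lee_fin.
    have := cutpow_le_bregman x (a * y) p12; lra.
- by move=> y _; rewrite lee_fin bregman_ge0.
- exact/measurable_EFinP.
- by move=> y _; rewrite -EFinM lee_fin mulr_ge0// cutpow_ge0.
- by apply: measurable_funeM; exact: measurable_cutpowM.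
Qed.

End cut_moment.

(** * Growth of E psi(S_n) along the partial sums *)

Lemma twentieth_le1 (R : realType) (s e : R) :
  e <= 2000^-1 -> s <= 20 * e -> s <= 1.
Proof. lra. Qed.

(** While e <= 1/2000 the loss 100 c e is at most c/20, so every step gains at least c/10 - c/20 =
    c/20. *)
Lemma growth_step (R : realType) (s c e e' : R) : 0 <= c -> e <= e' ->
  e' <= 2000^-1 -> e + c / 10 <= e' + 100 * c * e -> s <= 20 * e ->
  s + c <= 20 * e'.
Proof.
move=> c0 ee' e'K h hs; have : c * e <= c * 2000^-1.
  by rewrite ler_wpM2l// (le_trans ee').
lra.
Qed.

Section lincomb_moment.
Context (R : realType) (p : R) (d : measure_display) (T : measurableType d).
Context (P : probability T R) (X : nat -> {RV P >-> R}) (nu : probability R R).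
Hypothesis p12 : 1 <= p <= 2.
Hypothesis nup : (\int[nu]_y (`|y| `^ p)%:E < +oo)%E.
Hypothesis nu0 : (\int[nu]_y y%:E = 0)%E.
Hypothesis indX : mutually_independent X.
Hypothesis Xnu :
  forall k B, measurable B -> distribution P (X k) B = nu B.

Variable a : nat -> R.

Local Notation S := (lincomb X a).

Let J n := (\int[P]_w (jpow p (S n w))%:E)%E.

Let mJ n : measurable_fun setT (fun w => (jpow p (S n w))%:E).
Proof.
apply/measurable_EFinP; apply: (measurableT_comp (measurable_jpow p)).
exact: measurable_lincomb.
Qed.

Let mshift n :
  measurable_fun setT (fun z : R * R => (jpow p (z.1 + a n * z.2))%:E).
Proof.
apply/measurable_EFinP; apply: (measurableT_comp (measurable_jpow p)).
by apply: measurable_funD => //; exact: measurable_funM.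
Qed.

Let mK n : measurable_fun setT
  (fun w => \int[nu]_y (jpow p (S n w + a n * y))%:E)%E.
Proof.
have h := @measurable_fun_fubini_tonelli_F _ _ _ _ R nu _ (mshift n).
have /h{}h : forall z : R * R, (0 <= (jpow p (z.1 + a n * z.2))%:E)%E.
  by move=> z; rewrite lee_fin jpow_ge0.
by apply: (measurableT_comp h); exact: measurable_lincomb.
Qed.

(** X_n is independent of S_n, so it can be integrated out under its law with S_n frozen. *)
Let J_rec n : J n.+1 =
  (\int[P]_w \int[nu]_y (jpow p (S n w + a n * y))%:E)%E.
Proof.
rewrite /J; under eq_integral do rewrite lincombS.
rewrite (@ge0_integral_indep _ _ _ P _ (X n)
  (fun z => (jpow p (z.1 + a n * z.2))%:E) _ (mshift n)).
- apply: eq_integral => w _ /=; apply: eq_measure_integral => B mB _.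
  exact: Xnu.
- by move=> A B mA mB; exact: lincomb_indep1.
- by move=> z; rewrite lee_fin jpow_ge0.
Qed.

Let jpow_lincomb_ge0 n w : (0 <= (jpow p (S n w))%:E)%E.
Proof. by rewrite lee_fin jpow_ge0. Qed.

Let J0 : J 0 = 0%E.
Proof.
rewrite /J; under eq_integral do rewrite /lincomb big_ord0 jpow0.
exact: integral0.
Qed.

Let J_ge n : (J n <= J n.+1)%E.
Proof.
rewrite J_rec; apply: ge0_le_integral => // w _.
exact: integral_jpow_shift_ge.
Qed.

Let J_le n : (J n.+1 <= J n + (6 * cut_moment nu p (a n))%:E)%E.
Proof.
have c0 : (0 <= (6 * cut_moment nu p (a n))%:E)%E.
  by rewrite lee_fin mulr_ge0// cut_moment_ge0.
rewrite J_rec -(integral_probability_cst P) -ge0_integralD//.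
apply: ge0_le_integral => //.
- by move=> w _; rewrite integral_ge0// => y _; rewrite lee_fin jpow_ge0.
- exact: emeasurable_funD.
- by move=> w _; exact: integral_jpow_shift_le.
Qed.

Let J_growth n : (J n + (cut_moment nu p (a n) / 10)%:E <=
  J n.+1 + (100 * cut_moment nu p (a n))%:E * J n)%E.
Proof.
have c0 : (0 <= (cut_moment nu p (a n) / 10)%:E)%E.
  by rewrite lee_fin divr_ge0// cut_moment_ge0.
have c1 : (0 <= (100 * cut_moment nu p (a n))%:E)%E.
  by rewrite lee_fin mulr_ge0// cut_moment_ge0.
rewrite J_rec -(integral_probability_cst P (_ / 10)).
have shift0 w : (0 <= \int[nu]_y (jpow p (S n w + a n * y))%:E)%E.
  by rewrite integral_ge0// => y _; rewrite lee_fin jpow_ge0.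
rewrite -ge0_integralD// -ge0_integralZl// -ge0_integralD//.
- apply: ge0_le_integral => //.
  + by move=> w _; rewrite adde_ge0.
  + exact: emeasurable_funD.
  + by apply: emeasurable_funD => //; exact: measurable_funeM.
  + by move=> w _; exact: integral_jpow_shift_growth.
- by move=> w _; rewrite mule_ge0.
- exact: measurable_funeM.
Qed.

Let J_fin n : J n \is a fin_num.
Proof.
have Jge0 m : (0 <= J m)%E by exact: integral_ge0.
elim: n => [|n IH]; first by rewrite J0.
rewrite ge0_fin_numE//; apply: le_lt_trans (J_le n) _.
by rewrite -(fineK IH) -EFinD ltry.
Qed.

(** |u|^p <= 1 + psi(u), and the increments of E psi(S_n) sum up from J 0 = 0. *)
Lemma integral_lincomb_le n :
  (\int[P]_w (`|S n w| `^ p)%:E <=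
   (1 + 6 * \sum_(k < n) cut_moment nu p (a k))%:E)%E.
Proof.
have mS := mJ n.
apply: (@le_trans _ _ (\int[P]_w (1 + (jpow p (S n w))%:E))%E).
  apply: ge0_le_integral => //.
  - apply/measurable_EFinP; apply: (measurableT_comp (measurable_norm_powR p)).
    exact: measurable_lincomb.
  - exact: emeasurable_funD.
  - by move=> w _; rewrite -EFinD lee_fin powR_le_jpow.
rewrite ge0_integralD// integral_probability_cst EFinD leeD2l//.
elim: n {mS} => [|n IH]; first by rewrite -/(J 0) J0 big_ord0 mulr0.
rewrite -/(J n.+1) big_ord_recr/= mulrDr EFinD.
by apply: le_trans (J_le n) _; exact: leeD.
Qed.

(** E psi(S_m) is nondecreasing in m, so its smallness at n holds at all earlier m and [growth_step]
    applies throughout the induction. *)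
Lemma sum_cut_moment_le1 n :
  (\int[P]_w (`|S n w| `^ p)%:E <= 2000^-1%:E)%E ->
  \sum_(k < n) cut_moment nu p (a k) <= 1.
Proof.
move=> hS.
have {hS} : (J n <= 2000^-1%:E)%E.
  apply: le_trans hS; apply: ge0_le_integral => //.
  - apply/measurable_EFinP; apply: (measurableT_comp (measurable_norm_powR p)).
    exact: measurable_lincomb.
  - by move=> w _; rewrite lee_fin jpow_le_powR.
pose e m := fine (J m).
have JE m : J m = (e m)%:E by rewrite fineK.
have e0 : e 0%N = 0 by rewrite /e J0.
have e_ge m : e m <= e m.+1 by rewrite -lee_fin -!JE.
have e_growth m : e m + cut_moment nu p (a m) / 10 <=
    e m.+1 + 100 * cut_moment nu p (a m) * e m.
  by rewrite -lee_fin 2!EFinD (EFinM (100 * _)) -!JE.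
suff h m : e m <= 2000^-1 -> \sum_(k < m) cut_moment nu p (a k) <= 20 * e m.
  by rewrite JE lee_fin => en; exact: twentieth_le1 en (h n en).
elim: m => [|m IH em]; first by rewrite big_ord0 e0 mulr0.
rewrite big_ord_recr/=; apply: (growth_step _ (e_ge m) em (e_growth m)).
  exact: cut_moment_ge0.
by apply: IH; exact: le_trans em.
Qed.

End lincomb_moment.

(** * The rearrangement *)

Section rearrangement_law.
Context (R : realType) (d : measure_display) (T : measurableType d).
Context (P : probability T R) (Y : {RV P >-> R}) (f : R -> R).
Local Notation mu := (@lebesgue_measure R).
Hypothesis Y0 : forall w, 0 <= Y w.
Hypothesis ccdfY : forall t, ccdf Y t = distr_fun f t.

(** Right continuity of the distribution function, taken from the tail function of [Y], makes the
    defining infimum attained: f^*(s) <= t forces n_f(t) <= s. *)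
Lemma rearrangement_gt (s t : R) : 0 <= t ->
  (t%:E < rearrangement f s)%E = (s%:E < distr_fun f t)%E.
Proof.
move=> t0; apply/idP/idP.
  rewrite !ltNge; apply: contra => ts; apply: ereal_inf_lbound.
  by exists t.
rewrite !ltNge; apply: contra => rt; rewrite -ccdfY.
apply: (cvge_to_le (ccdf_right_continuous (X := Y) (x := t))).
near=> t'.
have : (rearrangement f s < t'%:E)%E.
  by apply: le_lt_trans rt _; rewrite lte_fin; near: t'; exact: nbhs_right_gt.
move=> /ereal_inf_lt[_ [u [u0 us] <-]]; rewrite lte_fin => ut'.
apply: le_trans us; rewrite -ccdfY; apply: ccdf_nonincreasing; exact: ltW.
Unshelve. all: end_near. Qed.

Lemma rearrangement_ge0 s : (0 <= rearrangement f s)%E.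
Proof. by apply: le_ereal_inf_tmp => _ [t [t0 _] <-]; rewrite lee_fin. Qed.

(** An infinite value would keep n_f(t) above s for all t, whereas n_f tends to 0. *)
Lemma rearrangement_fin_num s : 0 < s -> rearrangement f s \is a fin_num.
Proof.
move=> s0; rewrite ge0_fin_numE ?rearrangement_ge0//.
have [//|roo] := ltP (rearrangement f s) +oo%E.
have : (s%:E <= 0)%E.
  apply: (cvge_to_ge (cvg_ccdfy0 Y)); near=> t.
  apply: ltW; rewrite ccdfY -rearrangement_gt.
    by apply: lt_le_trans roo; exact: ltry.
  by near: t; exact: nbhs_pinfty_ge.
by rewrite lee_fin leNgt s0.
Unshelve. all: end_near. Qed.

(* Faithful only for s > 0: rearrangement f 0 may be +oo. *)
Definition rearrangementr s : R := fine (rearrangement f s).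

Lemma rearrangementrE s : 0 < s -> rearrangement f s = (rearrangementr s)%:E.
Proof. by move=> s0; rewrite fineK// rearrangement_fin_num. Qed.

Lemma rearrangementr_ge0 s : 0 <= rearrangementr s.
Proof. by rewrite fine_ge0// rearrangement_ge0. Qed.

Lemma rearrangementr_homo s t : 0 < s -> s <= t ->
  rearrangementr t <= rearrangementr s.
Proof.
move=> s0 st; rewrite -lee_fin -!rearrangementrE ?(lt_le_trans s0)//.
apply: le_ereal_inf_tmp => _ [u [u0 us] <-]; apply: ereal_inf_lbound.
by exists u => //; split => //; apply: le_trans us _; rewrite lee_fin.
Qed.

Let distr_fun_fin t : distr_fun f t \is a fin_num.
Proof. by rewrite -ccdfY fin_num_measure. Qed.

Let preimage_rearrangementr t : 0 <= t ->
  `]0, 1]%classic `&` rearrangementr @^-1` `]t, +oo[%classic =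
  `]0, fine (distr_fun f t)[%classic.
Proof.
move=> t0; have d1 : fine (distr_fun f t) <= 1.
  by rewrite -lee_fin fineK// -ccdfY probability_le1.
apply/seteqP; split => s /=; rewrite !in_itv/= ?andbT.
  move=> [/andP[s0 s1]]; rewrite -lte_fin -rearrangementrE// rearrangement_gt//.
  by rewrite -{1}(fineK (distr_fun_fin t)) lte_fin s0.
move=> /andP[s0 sd]; rewrite s0 (le_trans (ltW sd))//; split => //.
rewrite -lte_fin -rearrangementrE// rearrangement_gt//.
by rewrite -(fineK (distr_fun_fin t)) lte_fin.
Qed.

Let preimage_rearrangementr_neg t : t < 0 ->
  `]0, 1]%classic `&` rearrangementr @^-1` `]t, +oo[%classic = `]0, 1]%classic.
Proof.
move=> t0; apply/seteqP; split => s /=; first by case.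
by move=> ->; rewrite in_itv/= andbT (lt_le_trans t0)// rearrangementr_ge0.
Qed.

Lemma measurable_rearrangementr :
  measurable_fun (`]0, 1]%classic : set R) rearrangementr.
Proof.
apply: (measurability (@RGenOInfty.G R)) => [|_ [_ [t ->] <-]].
  exact: RGenOInfty.measurableE.
have [t0|t0] := leP 0 t; first by rewrite preimage_rearrangementr.
by rewrite preimage_rearrangementr_neg.
Qed.

(** Equimeasurability of f^* and |f|. The open upper rays form a generating pi-system; for t >= 0
    the preimage is an interval of length n_f(t), and for t < 0 both sides have mass 1. *)
Lemma rearrangementr_law B : measurable B ->
  mu (`]0, 1]%classic `&` rearrangementr @^-1` B) = distribution P Y B.
Proof.
pose D : set R := `]0, 1]%classic.
pose g := rearrangementr \_ D.
have mD : measurable D by exact: measurable_itv.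
have mg : measurable_fun setT g.
  by apply/(measurable_restrictT _ _).1 => //; exact: measurable_rearrangementr.
have gE B' : D `&` g @^-1` B' = D `&` rearrangementr @^-1` B'.
  by apply/seteqP; split => s [Ds] /=; rewrite /g patchE mem_set.
have [m1 m1E] : exists m : {measure set R -> \bar R}, forall B',
    m B' = mu (`]0, 1]%classic `&` rearrangementr @^-1` B').
  unshelve eexists (pushforward (mrestr mu mD) g); first exact: mg.
  by move=> B'; rewrite -gE setIC.
move=> mB; rewrite -m1E.
have m1oo B' : measurable B' -> (m1 B' < +oo)%E.
  move=> mB'; rewrite m1E; apply: (@le_lt_trans _ _ (mu `]0, 1]%classic)).
    apply: le_measure; [|by rewrite inE; exact: measurable_itv|exact: subIsetl].
    by rewrite inE; apply: measurable_rearrangementr => //; exact: measurable_itv.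
  by rewrite lebesgue_measure_itv/= lte_fin ltr01 -EFinB ltry.
apply: (measure_unique (@RGenOInfty.G R) (fun k => `](- k%:R), +oo[%classic)).
- exact: RGenOInfty.measurableE.
- move=> _ _ [x ->] [y ->]; exists (Num.max x y).
  by apply/seteqP; split => z /=; rewrite !in_itv/= !andbT gt_max => /andP.
- by move=> k; exists (- k%:R).
- apply/seteqP; split => // y _; exists (Num.bound `|y|) => //=.
  rewrite in_itv/= andbT ltrNl; apply: le_lt_trans (archi_boundP (normr_ge0 y)).
  by rewrite -normrN ler_norm.
- move=> _ [t ->]; rewrite m1E; have [t0|t0] := leP 0 t.
    rewrite preimage_rearrangementr// lebesgue_measure_itv/= lte_fin.
    rewrite -[RHS]/(ccdf Y t) ccdfY; case: ltP => [_|d0].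
      by rewrite -EFinB subr0 fineK.
    rewrite -(fineK (distr_fun_fin t)); congr _%:E.
    by apply/esym/le_anti; rewrite d0 fine_ge0// -ccdfY.
  rewrite preimage_rearrangementr_neg// lebesgue_measure_itv/= lte_fin ltr01.
  rewrite -EFinB subr0 /distribution/= /pushforward.
  rewrite (_ : _ @^-1` _ = setT) ?probability_setT//.
  by apply/seteqP; split => // w _ /=; rewrite in_itv/= andbT (lt_le_trans t0).
- by move=> k; apply: m1oo.
- exact: mB.
Qed.

End rearrangement_law.

(** Removes the outer root from a power mean. It serves both summands of F, with r = p and r = 2,
    and the L_p norm, with t = 1. *)
Lemma poweR_mean_le (R : realType) (r t c : R) (I : \bar R) :
  0 < r -> 0 < t -> 0 <= c -> (0 <= I)%E ->
  ((t^-1%:E * I) `^ r^-1 <= c%:E)%E = (I <= (t * c `^ r)%:E)%E.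
Proof.
move=> r0 t0 c0 I0; have r0' : r != 0 by rewrite gt_eqF.
rewrite EFinM -lee_pdivrMl//; set u := (_ * I)%E.
have u0 : (0 <= u)%E by rewrite mule_ge0// lee_fin invr_ge0 ltW.
apply/idP/idP => h.
  have -> : u = ((u `^ r^-1) `^ r)%E by rewrite -poweRrM mulVf// poweRe1.
  rewrite -poweR_EFin; apply: gt0_ler_poweR => //; first exact: ltW.
  - by rewrite in_itv/= leey poweR_ge0.
  - by rewrite in_itv/= lee_fin c0 leey.
have -> : c%:E = ((c `^ r)%:E `^ r^-1)%E.
  by rewrite poweR_EFin -powRrM mulfV// powRr1.
apply: gt0_ler_poweR => //; first by rewrite invr_ge0 ltW.
- by rewrite in_itv/= u0 leey.
- by rewrite in_itv/= lee_fin powR_ge0 leey.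
Qed.

(** * The function F and the moment Phi *)

Section mixed_average.
Context (R : realType) (p : R) (nu : probability R R) (G : R -> R).
Local Notation mu := (@lebesgue_measure R).
Hypothesis p12 : 1 <= p <= 2.
Hypothesis mG : measurable_fun (`]0, 1]%classic : set R) G.
Hypothesis G0 : forall s, 0 <= G s.
Hypothesis G_homo : forall s t, 0 < s -> s <= t -> G t <= G s.
Hypothesis Gnu : forall x,
  (\int[mu]_(s in `]0%R, 1%R]) (cutpow p (x * G s))%:E)%E =
  (cut_moment nu p x)%:E.

(* F of the header for G = f^*; the missing endpoints are Lebesgue-null. *)
Definition mixed_average t : \bar R :=
  ((t^-1%:E * \int[mu]_(s in `]0%R, t]) (G s `^ p)%:E) `^ p^-1 +
   (t^-1%:E * \int[mu]_(s in `]t, 1%R]) (G s ^+ 2)%:E) `^ 2^-1)%E.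

Variables t x : R.
Hypothesis t01 : 0 < t <= 1.
Hypothesis x0 : 0 < x.

Let t0 : 0 < t. Proof. by case/andP: t01. Qed.
Let t1 : t <= 1. Proof. by case/andP: t01. Qed.

Let sub0t : `]0, t]%classic `<=` (`]0, 1]%classic : set R).
Proof. by apply: subset_itvl; rewrite bnd_simp. Qed.

Let subt1 : `]t, 1]%classic `<=` (`]0, 1]%classic : set R).
Proof. by apply: subset_itvr; rewrite bnd_simp ltW. Qed.

Let mG0t : measurable_fun (`]0, t]%classic : set R) G.
Proof. exact: measurable_funS mG. Qed.

Let mGt1 : measurable_fun (`]t, 1]%classic : set R) G.
Proof. exact: measurable_funS mG. Qed.

Let mGp : measurable_fun (`]0, t]%classic : set R) (fun s => (G s `^ p)%:E).
Proof.
by apply/measurable_EFinP; apply: (measurableT_comp (measurable_powR p)).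
Qed.

Let mG2 : measurable_fun (`]t, 1]%classic : set R) (fun s => (G s ^+ 2)%:E).
Proof. by apply/measurable_EFinP; exact: measurable_funX. Qed.

Let mcut D : measurable_fun D G ->
  measurable_fun D (fun s => (cutpow p (x * G s))%:E).
Proof.
move=> mGD; apply/measurable_EFinP.
by apply: (measurableT_comp (measurable_cutpow p)); exact: measurable_funM.
Qed.

Let cut0 D s : D s -> (0 <= (cutpow p (x * G s))%:E)%E.
Proof. by rewrite lee_fin cutpow_ge0. Qed.

Let split_moment : ((cut_moment nu p x)%:E =
  \int[mu]_(s in `]0%R, t]) (cutpow p (x * G s))%:E +
  \int[mu]_(s in `]t, 1%R]) (cutpow p (x * G s))%:E)%E.
Proof.
have U01 : `]0, 1]%classic = (`]0, t]%classic `|` `]t, 1]%classic : set R).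
  by rewrite -itv_bndbnd_setU// bnd_simp// ltW.
rewrite -Gnu U01 ge0_integral_setU//=.
- by apply: mcut; rewrite -U01.
- by move=> s _; rewrite lee_fin cutpow_ge0.
- apply/disj_setPS => s [/=]; rewrite !in_itv/= => /andP[_ st] /andP[ts _].
  by move: ts; rewrite ltNge st.
Qed.

Let I1 : (0 <= \int[mu]_(s in `]0%R, t]) (G s `^ p)%:E)%E.
Proof. by apply: integral_ge0 => s _; rewrite lee_fin powR_ge0. Qed.

Let I2 : (0 <= \int[mu]_(s in `]t, 1%R]) (G s ^+ 2)%:E)%E.
Proof. by apply: integral_ge0 => s _; rewrite lee_fin sqr_ge0. Qed.

(** phi is bounded by |u|^p on ]0, t] and by u^2 on ]t, 1]. Each summand of F(t) is at most 1/x, so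
    each piece of the integral is at most t. *)
Lemma cut_moment_le_of_mixed_average :
  (mixed_average t <= x^-1%:E)%E -> cut_moment nu p x <= 2 * t.
Proof.
have /andP[p1 p2] := p12; have x0' := ltW x0.
move=> h.
have h1 : (\int[mu]_(s in `]0%R, t]) (G s `^ p)%:E <= (t * x^-1 `^ p)%:E)%E.
  rewrite -poweR_mean_le// ?invr_ge0//; last lra.
  by apply: le_trans h; rewrite leeDl// poweR_ge0.
have h2 : (\int[mu]_(s in `]t, 1%R]) (G s ^+ 2)%:E <= (t * x^-1 `^ 2)%:E)%E.
  rewrite -poweR_mean_le// ?invr_ge0//.
  by apply: le_trans h; rewrite leeDr// poweR_ge0.
rewrite -lee_fin split_moment (_ : 2 * t = t + t); last by ring.
rewrite EFinD; apply: leeD.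
  apply: (@le_trans _ _ ((x `^ p)%:E * (t * x^-1 `^ p)%:E)%E); last first.
    by rewrite -EFinM lee_fin mulrCA -powRM ?invr_ge0// divff ?gt_eqF// powR1 mulr1.
  apply: (@le_trans _ _ ((x `^ p)%:E *
      \int[mu]_(s in `]0%R, t]) (G s `^ p)%:E)%E); last first.
    by rewrite lee_wpmul2l// lee_fin powR_ge0.
  rewrite -ge0_integralZl//; last 2 first.
  - by move=> s _; rewrite lee_fin powR_ge0.
  - by rewrite lee_fin powR_ge0.
  apply: ge0_le_integral => //.
  - by move=> s; exact: cut0.
  - exact: mcut.
  - exact: measurable_funeM.
  - move=> s _; rewrite -EFinM lee_fin -powRM// ge_min ger0_norm ?mulr_ge0//.
    by rewrite lexx orbT.
apply: (@le_trans _ _ ((x ^+ 2)%:E * (t * x^-1 `^ 2)%:E)%E); last first.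
  rewrite -EFinM lee_fin powR_mulrn ?invr_ge0// mulrCA -exprMn divff ?gt_eqF//.
  by rewrite expr1n mulr1.
apply: (@le_trans _ _ ((x ^+ 2)%:E *
    \int[mu]_(s in `]t, 1%R]) (G s ^+ 2)%:E)%E); last first.
  by rewrite lee_wpmul2l// lee_fin sqr_ge0.
rewrite -ge0_integralZl//; last 2 first.
- by move=> s _; rewrite lee_fin sqr_ge0.
- by rewrite lee_fin sqr_ge0.
apply: ge0_le_integral => //.
- by move=> s; exact: cut0.
- exact: mcut.
- exact: measurable_funeM.
- by move=> s _; rewrite -EFinM lee_fin -exprMn ge_min lexx.
Qed.

(** If x G(s) > 1, then by monotonicity phi(x G) >= 1 on all of ]0, s], and Phi x >= s > t. *)
Let small_tail s : cut_moment nu p x <= t -> t < s -> s <= 1 -> x * G s <= 1.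
Proof.
have /andP[p1 p2] := p12; have x0' := ltW x0.
move=> xt ts s1; rewrite leNgt; apply/negP => xG.
have s0 : 0 < s := lt_trans t0 ts.
have cut1 u : u \in `]0, s] -> 1 <= cutpow p (x * G u).
  rewrite in_itv/= => /andP[u0 us].
  have xGu : 1 <= x * G u by apply: le_trans (ltW xG) _; rewrite ler_pM2l// G_homo.
  rewrite /cutpow le_min ger0_norm ?mulr_ge0// expr2 mulr_ege1//=.
  by rewrite -[leLHS](powRr0 (x * G u)) ler_powR//; lra.
have : (s%:E <= (cut_moment nu p x)%:E)%E.
  rewrite -Gnu; apply: (@le_trans _ _ (\int[mu]_(u in `]0%R, s]) 1%:E)%E).
    rewrite integral_cst//= lebesgue_measure_itv/= lte_fin s0 mul1e.
    by rewrite -EFinB subr0.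
  apply: (@le_trans _ _ (\int[mu]_(u in `]0%R, s]) (cutpow p (x * G u))%:E)%E).
    apply: ge0_le_integral => //.
      apply: mcut; apply: measurable_funS mG => //.
      by apply: subset_itvl; rewrite bnd_simp.
  apply: ge0_subset_integral; [exact: measurable_itv|exact: measurable_itv|exact: mcut| |].
    by move=> u _; rewrite lee_fin cutpow_ge0.
  by apply: subset_itvl; rewrite bnd_simp.
by rewrite lee_fin => /(lt_le_trans ts); rewrite ltNge xt.
Qed.

(** On ]0, t], u^p <= 1 + phi(u) gives an integral at most 2t <= t 2^p, so the first summand is at
    most 2/x. On ]t, 1], [small_tail] turns phi into the square, and the second is at most 1/x. *)
Lemma mixed_average_le_of_cut_moment :
  cut_moment nu p x <= t -> (mixed_average t <= (3 / x)%:E)%E.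
Proof.
have /andP[p1 p2] := p12; have x0' := ltW x0.
have p0 : 0 < p by lra.
move=> xt.
have J1 : (0 <= \int[mu]_(s in `]0%R, t]) (cutpow p (x * G s))%:E)%E.
  by apply: integral_ge0 => s; exact: cut0.
have J2 : (0 <= \int[mu]_(s in `]t, 1%R]) (cutpow p (x * G s))%:E)%E.
  by apply: integral_ge0 => s; exact: cut0.
have J1t : (\int[mu]_(s in `]0%R, t]) (cutpow p (x * G s))%:E <= t%:E)%E.
  by apply: (@le_trans _ _ (cut_moment nu p x)%:E); rewrite ?lee_fin// split_moment leeDl.
have J2t : (\int[mu]_(s in `]t, 1%R]) (cutpow p (x * G s))%:E <= t%:E)%E.
  by apply: (@le_trans _ _ (cut_moment nu p x)%:E); rewrite ?lee_fin// split_moment leeDr.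
rewrite (_ : 3 / x = 2 / x + 1 / x); last by field; rewrite gt_eqF.
rewrite EFinD; apply: leeD.
  rewrite poweR_mean_le// ?divr_ge0//.
  have -> : t * (2 / x) `^ p = (x^-1) `^ p * (t * 2 `^ p).
    by rewrite powRM// ?invr_ge0//; ring.
  rewrite EFinM.
  apply: (@le_trans _ _ ((x^-1 `^ p)%:E * (t + t)%:E)%E); last first.
    rewrite lee_wpmul2l ?lee_fin ?powR_ge0//.
    rewrite (_ : t + t = t * 2); last by ring.
    rewrite ler_wpM2l ?(ltW t0)// le1r_powR//; lra.
  rewrite (_ : \int[mu]_(s in _) _ = (x^-1 `^ p)%:E *
      \int[mu]_(s in `]0%R, t]) ((x * G s) `^ p)%:E)%E.
    rewrite lee_wpmul2l ?lee_fin ?powR_ge0//.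
    apply: (@le_trans _ _ (\int[mu]_(s in `]0%R, t])
        (1%:E + (cutpow p (x * G s))%:E))%E).
      apply: ge0_le_integral => //.
      - by move=> s _; rewrite lee_fin powR_ge0.
      - apply/measurable_EFinP; apply: (measurableT_comp (measurable_powR p)).
        exact: measurable_funM.
      - by apply: emeasurable_funD => //; exact: mcut.
      - move=> s _; rewrite -EFinD lee_fin.
        have xG : 0 <= x * G s by rewrite mulr_ge0.
        rewrite /cutpow ger0_norm// addr_minr le_min (ler_wpDl _ (lexx _))//=.
        rewrite andbT.
        have [xG1|/ltW xG1] := leP (x * G s) 1.
          rewrite ler_wpDr ?sqr_ge0//; apply: (@le_trans _ _ (1 `^ p)).
            by rewrite ge0_ler_powR ?nnegrE// ltW.
          by rewrite powR1.
        rewrite ler_wpDl// -powR_mulrn// ler_powR//.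
    rewrite ge0_integralD//=; last 2 first.
    - by move=> s _; rewrite lee_fin cutpow_ge0.
    - exact: mcut.
    rewrite integral_cst//= lebesgue_measure_itv/= lte_fin t0 mul1e oppr0 adde0.
    by rewrite EFinD leeD2l.
  rewrite -ge0_integralZl//.
  - apply: eq_integral => s _; rewrite -EFinM -powRM ?invr_ge0 ?mulr_ge0//.
    by rewrite mulKf ?gt_eqF.
  - apply/measurable_EFinP; apply: (measurableT_comp (measurable_powR p)).
    exact: measurable_funM.
  - by move=> s _; rewrite lee_fin powR_ge0.
  - by rewrite lee_fin powR_ge0.
rewrite poweR_mean_le// ?divr_ge0//.
have -> : t * (1 / x) `^ 2 = (x^-1) ^+ 2 * t.
  by rewrite div1r powR_mulrn ?invr_ge0// mulrC.
rewrite EFinM.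
apply: (@le_trans _ _ ((x^-1 ^+ 2)%:E *
    \int[mu]_(s in `]t, 1%R]) (cutpow p (x * G s))%:E)%E); last first.
  by rewrite lee_wpmul2l ?lee_fin ?sqr_ge0.
rewrite -ge0_integralZl//; last 3 first.
- exact: mcut.
- by move=> s; exact: cut0.
- by rewrite lee_fin sqr_ge0.
apply: ge0_le_integral => //.
- by move=> s _; rewrite lee_fin sqr_ge0.
- by apply: measurable_funeM; exact: mcut.
move=> s; rewrite /= in_itv/= => /andP[ts s1].
have xG : 0 <= x * G s by rewrite mulr_ge0.
have xG1 := small_tail xt ts s1.
rewrite -EFinM lee_fin /cutpow ger0_norm// min_l.
  by rewrite -exprMn mulKf ?gt_eqF.
have [->|xGn0] := eqVneq (x * G s) 0; first by rewrite expr0n/= powR_ge0.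
rewrite -powR_mulrn// ger_powR// lt_neqAle eq_sym xGn0 xG//.
Qed.

End mixed_average.

(** * Orlicz functions *)

Section orlicz.
Context (R : realType) (M : R -> R).
Hypothesis MO : orlicz_function M.

Let A := `[0, +oo[%classic : set R.

Let inA x : 0 <= x -> x \in A.
Proof. by move=> x0; rewrite inE /A/= in_itv/= x0. Qed.

Lemma orlicz_lt x y : 0 <= x -> x < y -> M x < M y.
Proof.
by move=> x0 xy; apply: (orlicz_incr MO) => //; apply: inA => //;
   exact: le_trans (ltW xy).
Qed.

Lemma orlicz_le x y : 0 <= x -> x <= y -> M x <= M y.
Proof.
by move=> x0; rewrite le_eqVlt => /predU1P[->//|xy]; rewrite ltW// orlicz_lt.
Qed.

Lemma orlicz_ge0 x : 0 <= x -> 0 <= M x.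
Proof. by move=> x0; rewrite -(orlicz0 MO) orlicz_le. Qed.

Lemma orlicz_inv_ge0 t : 0 <= t -> 0 <= orlicz_inv M t.
Proof.
move=> t0; have [_ _ Msurj] := orlicz_bij MO.
have : A (orlicz_inv M t).
  apply: (surjpinv_image_sub (dflt := fun=> 0) Msurj).
  by exists t => //; exact/set_mem/inA.
by rewrite /A/= in_itv/= andbT.
Qed.

Lemma orlicz_invK t : 0 <= t -> M (orlicz_inv M t) = t.
Proof.
move=> t0; have [_ _ Msurj] := orlicz_bij MO.
by rewrite /orlicz_inv (surjpK _ Msurj)// inA.
Qed.

Lemma orliczK x : 0 <= x -> orlicz_inv M (M x) = x.
Proof.
move=> x0; have [_ Minj _] := orlicz_bij MO.
by rewrite /orlicz_inv pinvKV// inA.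
Qed.

Lemma orlicz_inv_gt0 t : 0 < t -> 0 < orlicz_inv M t.
Proof.
move=> t0; have := orlicz_inv_ge0 (ltW t0).
rewrite le_eqVlt => /predU1P[h|//]; have := orlicz_invK (ltW t0).
by rewrite -h (orlicz0 MO) => h0; rewrite -h0 ltxx in t0.
Qed.

Lemma le_orlicz_inv x t : 0 <= t -> M x <= t -> x <= orlicz_inv M t.
Proof.
move=> t0; have [x0|x0 _] := leP 0 x; last by rewrite (le_trans (ltW x0))// orlicz_inv_ge0.
rewrite leNgt => Mx; rewrite leNgt; apply: contra Mx => xt.
by rewrite -(orlicz_invK t0) orlicz_lt// orlicz_inv_ge0.
Qed.

Lemma orlicz_le_inv x t : 0 <= x -> 0 <= t -> x <= orlicz_inv M t -> M x <= t.
Proof. by move=> x0 t0 xt; rewrite -(orlicz_invK t0) orlicz_le. Qed.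

(** Convexity between x and 0, where M vanishes. *)
Lemma orlicz_scale l x : 0 <= l <= 1 -> 0 <= x -> M (l * x) <= l * M x.
Proof.
move=> /andP[l0 l1] x0.
have := orlicz_convex MO (Itv01 l0 l1) (inA x0) (inA (lexx 0)).
rewrite !convRE/= (orlicz0 MO) mulr0 addr0.
rewrite [X in M X](_ : _ = l * x)//.
by rewrite -[LHS]/(l * x + (1 - l) * 0) mulr0 addr0.
Qed.

(** Convexity gives 2 M(u) <= M(2u) at u = M^-1(t). This allows t to be replaced by a comparable
    1/n. *)
Lemma orlicz_inv_double t : 0 <= t -> orlicz_inv M (2 * t) <= 2 * orlicz_inv M t.
Proof.
move=> t0; have m0 := orlicz_inv_ge0 t0.
rewrite -(@orliczK (2 * orlicz_inv M t)) ?mulr_ge0//.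
apply: le_orlicz_inv; first by rewrite orlicz_ge0// mulr_ge0.
rewrite orlicz_invK ?mulr_ge0//.
have := @orlicz_scale 2^-1 (2 * orlicz_inv M t).
rewrite mulKf// orlicz_invK// => /(_ _ _)/=.
move=> h; have : t <= 2^-1 * M (2 * orlicz_inv M t).
  by apply: h; [apply/andP; split; lra|rewrite mulr_ge0].
lra.
Qed.

Lemma finite_nneseries (u : nat -> \bar R) n : (forall k, (0 <= u k)%E) ->
  (forall k, (n <= k)%N -> u k = 0%E) ->
  (\sum_(0 <= k <oo) u k = \sum_(k < n) u k)%E.
Proof.
move=> u0 un; rewrite (nneseries_split 0 n)// add0n.
by rewrite [X in (_ + X)%E]eseries0 ?adde0 ?big_mkord// => k nk _; exact: un.
Qed.

Let series_orlicz n (a : nat -> R) rho : 0 < rho ->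
  (forall k, (n <= k)%N -> a k = 0) ->
  (\sum_(0 <= k <oo) (M (`|a k| / rho))%:E =
   (\sum_(k < n) M (`|a k| / rho))%:E)%E.
Proof.
move=> r0 an; rewrite (@finite_nneseries _ n) ?sumEFin// => k.
  by rewrite lee_fin orlicz_ge0// divr_ge0// ltW.
by move=> /an ->; rewrite normr0 mul0r (orlicz0 MO).
Qed.

Lemma orlicz_norm_le n (a : nat -> R) rho : 0 < rho ->
  (forall k, (n <= k)%N -> a k = 0) ->
  \sum_(k < n) M (`|a k| / rho) <= 1 -> (orlicz_norm M a <= rho%:E)%E.
Proof.
move=> r0 an h; apply: ereal_inf_lbound; exists rho => //; split => //.
by rewrite (series_orlicz r0 an) lee_fin.
Qed.

Lemma le_orlicz_norm n (a : nat -> R) (u : \bar R) :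
  (forall k, (n <= k)%N -> a k = 0) ->
  (forall rho, 0 < rho -> \sum_(k < n) M (`|a k| / rho) <= 1 -> (u <= rho%:E)%E) ->
  (u <= orlicz_norm M a)%E.
Proof.
move=> an h; apply: le_ereal_inf_tmp => _ [rho [r0 +] <-].
by rewrite (series_orlicz r0 an) lee_fin; exact: h.
Qed.

(** The constraint on rho reads n M(1/rho) <= 1, that is 1/rho <= M^-1(1/n). *)
Lemma orlicz_norm_ones n : (0 < n)%N ->
  orlicz_norm M (fun k => (k < n)%:R) = ((orlicz_inv M n%:R^-1)^-1)%:E.
Proof.
move=> n0; have n0' : 0 < n%:R^-1 :> R by rewrite invr_gt0 ltr0n.
have r0 := orlicz_inv_gt0 n0'; have supp k : (n <= k)%N -> (k < n)%:R = 0 :> R.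
  by rewrite leqNgt => /negbTE ->.
have sumE rho : \sum_(k < n) M (`|(k < n)%:R| / rho) = n%:R * M rho^-1.
  under eq_bigr do rewrite ltn_ord normr1 mul1r.
  by rewrite sumr_const card_ord mulr_natl.
apply/le_anti/andP; split.
  apply: (orlicz_norm_le _ supp); first by rewrite invr_gt0.
  have n1 : n%:R != 0 :> R by rewrite pnatr_eq0 -lt0n.
  by rewrite sumE invrK orlicz_invK ?(ltW n0')// mulfV.
apply: (le_orlicz_norm supp) => rho rho0; rewrite sumE => h.
rewrite lee_fin -[rho]invrK lef_pV2 ?posrE ?invr_gt0//.
by apply: le_orlicz_inv; [exact: ltW|rewrite -[leRHS]mul1r ler_pdivlMr ?ltr0n// mulrC].
Qed.

End orlicz.

(** * Comparison of Phi with M through F *)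

Section orlicz_comparison.
Context (R : realType) (M : R -> R) (Phi : R -> R) (F : R -> \bar R).
Variable N : nat -> (nat -> R) -> \bar R.
Hypothesis MO : orlicz_function M.
Hypothesis Phi_norm : forall x, Phi `|x| = Phi x.
Hypothesis Phi_ge0 : forall x, 0 <= Phi x.
Hypothesis Phi_scale : forall l x, 0 <= l <= 1 -> Phi (l * x) <= l * Phi x.
Hypothesis F_le : forall t x, 0 < t <= 1 -> 0 < x -> Phi x <= t ->
  (F t <= (3 / x)%:E)%E.
Hypothesis Phi_le : forall t x, 0 < t <= 1 -> 0 < x -> (F t <= x^-1%:E)%E ->
  Phi x <= 2 * t.
(** Taken to be 2000 in the application; the bound 5 ensures 3K/2 > 7 and 3K >= 14, which close the
    constants below. *)
Variable K : R.
Hypothesis K5 : 5 <= K.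
Hypothesis N_ge0 : forall n a, (0 <= N n a)%E.
Hypothesis N_le : forall n (a : nat -> R) (rho : R), 0 < rho ->
  \sum_(k < n) Phi (a k) <= 1 ->
  (N n (fun k => (rho * a k)%R) <= (7 * rho)%:E)%E.
Hypothesis sum_Phi_le1 : forall n (a : nat -> R) (rho : R), 0 < rho ->
  (N n a <= rho%:E)%E ->
  \sum_(k < n) Phi ((K * rho)^-1 * a k) <= 1.

Local Notation m := (orlicz_inv M).

Let K0 : 0 < K. Proof. by rewrite (lt_le_trans _ K5). Qed.

Let Phi0 : Phi 0 = 0.
Proof.
apply/le_anti; rewrite Phi_ge0 andbT.
have := @Phi_scale 0 0; rewrite mul0r => /(_ _) h.
by apply: (le_trans (h _)); rewrite ?mul0r// lexx ler01.
Qed.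

(** F is controlled on ]0, 1] only, so M and Phi are compared where their values are at most 1; the
    terms of an admissible sum satisfy this. *)
Let term_le1 n (u : 'I_n -> R) k :
  (forall i, 0 <= u i) -> \sum_(i < n) u i <= 1 -> u k <= 1.
Proof.
move=> u0; apply: le_trans; rewrite (bigD1 k)//= lerDl.
by apply: sumr_ge0 => i _.
Qed.

(** At t = M b the hypothesis reads F(t) <= C/b, hence Phi(b/C) <= 2 M b; halving the argument
    removes the factor 2. *)
Let Phi_le_orlicz C b : 0 < C ->
  (forall t, 0 < t <= 1 -> (F t <= C%:E * (m t)^-1%:E)%E) ->
  0 <= b -> M b <= 1 -> Phi (b / (2 * C)) <= M b.
Proof.
move=> C0 hF; rewrite le_eqVlt => /predU1P[<- _|b0 Mb].
  by rewrite mul0r Phi0 (orlicz0 MO).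
have Mb0 : 0 < M b by rewrite -(orlicz0 MO) orlicz_lt.
have t01 : 0 < M b <= 1 by rewrite Mb0.
have bC : 0 < b / C by rewrite divr_gt0.
have : Phi (b / C) <= 2 * M b.
  apply: Phi_le => //; rewrite invf_div.
  by have := hF _ t01; rewrite (orliczK MO (ltW b0)) -EFinM.
have := @Phi_scale 2^-1 (b / C).
have -> : 2^-1 * (b / C) = b / (2 * C) by field; rewrite gt_eqF.
have h2 : 0 <= (2^-1 : R) <= 1 by apply/andP; split; lra.
move=> /(_ h2); lra.
Qed.

(** At t = Phi b, F(t) <= 3/b gives M^-1(t) >= b/(3C). *)
Let orlicz_le_Phi C b : 0 < C ->
  (forall t, 0 < t <= 1 -> (C^-1%:E * (m t)^-1%:E <= F t)%E) ->
  0 <= b -> Phi b <= 1 -> M (b / (3 * C)) <= Phi b.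
Proof.
move=> C0 hF; rewrite le_eqVlt => /predU1P[<- _|b0 Phib].
  by rewrite mul0r Phi0 (orlicz0 MO).
have C3 : 0 < 3 * C by lra.
have bC : 0 <= b / (3 * C) by rewrite divr_ge0// ltW.
have key t : 0 < t <= 1 -> Phi b <= t -> M (b / (3 * C)) <= t.
  move=> t01 bt; have /andP[t0 t1] := t01.
  have m0 := orlicz_inv_gt0 MO t0.
  apply: (orlicz_le_inv MO) => //; first exact: ltW.
  have := le_trans (hF _ t01) (F_le t01 b0 bt).
  rewrite -EFinM lee_fin -invfM -invf_div lef_pV2 ?posrE ?mulr_gt0 ?divr_gt0//.
  rewrite ler_pdivrMr// => h; rewrite ler_pdivrMr//; lra.
have := Phi_ge0 b; rewrite le_eqVlt => /predU1P[Phib0|Phib0]; last first.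
  by apply: key => //; rewrite Phib0.
(* When Phi b = 0 the choice t = Phi b is not admissible; a positive t below v gives the
   contradiction. *)
rewrite -Phib0 leNgt; apply/negP => v0; set v := M _ in v0 key.
have t01 : 0 < Num.min 1 (v / 2) <= 1.
  by rewrite lt_min ltr01 divr_gt0//= ge_min lexx.
have := key _ t01; rewrite -Phib0 => /(_ (ltW _))/=.
move=> h; have : v <= Num.min 1 (v / 2) by apply: h; case/andP: t01.
by rewrite le_min => /andP[_]; lra.
Qed.

Let supported_ones n k : (n <= k)%N -> (k < n)%:R = 0 :> R.
Proof. by rewrite leqNgt => /negbTE ->. Qed.

(** n is the integer part of 1/t plus one, so 1/t < n <= 1/t + 1 <= 2/t. *)
Let exists_reciprocal t : 0 < t <= 1 ->
  exists2 n, (0 < n)%N & (n%:R^-1 <= t :> R) /\ t <= 2 * n%:R^-1.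
Proof.
move=> /andP[t0 t1]; have ti : 1 <= t^-1 by rewrite invf_ge1.
have /truncn_itv/andP[h1 h2] : 0 <= t^-1 by lra.
exists (Num.truncn t^-1).+1 => //.
have n0 : 0 < (Num.truncn t^-1).+1%:R :> R by rewrite ltr0n.
split; first by rewrite -[leRHS]invrK lef_pV2 ?posrE ?invr_gt0// ltW.
rewrite ler_pdivlMr//.
have : t * (Num.truncn t^-1).+1%:R <= t * (t^-1 + 1).
  by rewrite ler_pM2l// -natr1 lerD2r.
rewrite mulrDr mulfV ?gt_eqF//; lra.
Qed.

Lemma orlicz_comparison :
  (exists2 C : R, 0 < C & forall (n : nat) (a : nat -> R),
     (forall k, (n <= k)%N -> a k = 0) ->
     ((C^-1)%:E * orlicz_norm M a <= N n a)%E /\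
     (N n a <= C%:E * orlicz_norm M a)%E) <->
  asymp_on `]0, 1] (fun t => ((m t)^-1)%:E) F.
Proof.
split=> -[C C0 hC].
  (* The factor 6 is 3 from [F_le] times 2 for replacing 1/n by t. *)
  exists (6 * K * C); first by rewrite !mulr_gt0.
  move=> t; rewrite /= in_itv/= => t01; have /andP[t0 t1] := t01.
  have [n n0 [nt tn]] := exists_reciprocal t01.
  have n0' : 0 < n%:R^-1 :> R by rewrite invr_gt0 ltr0n.
  have nn : n%:R * n%:R^-1 = 1 :> R by rewrite mulfV// pnatr_eq0 -lt0n.
  have r0 := orlicz_inv_gt0 MO n0'; have m0 := orlicz_inv_gt0 MO t0.
  have [] := hC n _ (@supported_ones n); rewrite orlicz_norm_ones// -!EFinM.
  have ones_sum (u : R) : \sum_(k < n) Phi (u * (k < n)%:R) = n%:R * Phi u.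
    under eq_bigr do rewrite ltn_ord mulr1.
    by rewrite sumr_const card_ord mulr_natl.
  set r := m n%:R^-1 in r0 *; move=> lo hi; split.
    (* Otherwise F(t) < 1/x gives Phi x <= 2t <= 4/n, so the vector with n entries x/4 has modular
       at most 1. Then [N_le] and the lower norm bound force x/4 <= 7 C M^-1(t), while x/4 = (3/2) K
       C M^-1(t) is larger. *)
    rewrite -invfM leNgt; apply/negP => Flt.
    set x := 6 * K * C * m t in Flt; have x0 : 0 < x by rewrite !mulr_gt0.
    have Phix : Phi (4^-1 * x) <= n%:R^-1.
      have := Phi_le t01 x0 (ltW Flt); have := @Phi_scale 4^-1 x.
      have h4 : 0 <= (4^-1 : R) <= 1 by apply/andP; split; lra.
      move=> /(_ h4); lra.
    have : \sum_(k < n) Phi (4^-1 * x * (k < n)%:R) <= 1.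
      by rewrite ones_sum -[leRHS]nn ler_pM2l ?ltr0n.
    have rho0 : 0 < (4^-1 * x)^-1 by rewrite invr_gt0 mulr_gt0.
    move=> /(@N_le n (fun k => 4^-1 * x * (k < n)%:R) _ rho0).
    rewrite (_ : (fun k => _) = (fun k => (k < n)%:R)); last first.
      by apply/funext => k; rewrite mulrA mulVf ?mul1r// gt_eqF// mulr_gt0.
    move=> /(le_trans lo); rewrite lee_fin -invfM => h.
    have : 4^-1 * x <= 7 * (C * r).
      have Cr : 0 < C * r by rewrite !mulr_gt0.
      move: h; rewrite -[leRHS]invrK lef_pV2 ?posrE// ?invr_gt0 ?mulr_gt0//.
      by rewrite invf_div ler_pdivrMr// [leRHS]mulrC.
    have rm : r <= m t.
      by apply: (le_orlicz_inv MO); [exact: ltW|rewrite (orlicz_invK MO (ltW n0'))].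
    have : C * r <= C * m t by rewrite ler_pM2l.
    have : 0 < C * m t by rewrite !mulr_gt0.
    have : 5 * (C * m t) <= K * (C * m t) by rewrite ler_pM2r ?mulr_gt0.
    by rewrite /x; lra.
  have Cr : 0 < C * r^-1 by rewrite mulr_gt0 ?invr_gt0.
  (* The upper norm bound on the indicator vector gives n Phi(r/(KC)) <= 1, and 1/n <= t. *)
  have Phi1 : Phi (K * (C * r^-1))^-1 <= t.
    apply: le_trans nt; have := @sum_Phi_le1 _ _ _ Cr hi.
    by rewrite ones_sum -[leRHS]nn ler_pM2l// ltr0n.
  have x0 : 0 < (K * (C * r^-1))^-1 by rewrite invr_gt0 mulr_gt0.
  apply: le_trans (F_le t01 x0 Phi1) _; rewrite lee_fin invrK.
  have mr : m t <= 2 * r.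
    apply: le_trans (orlicz_inv_double MO (ltW n0')).
    apply: (le_orlicz_inv MO); first by rewrite mulr_ge0// ltW.
    by rewrite (orlicz_invK MO (ltW t0)).
  have : r^-1 <= 2 * (m t)^-1.
    by rewrite ler_pdivlMr// mulrC ler_pdivrMr.
  move=> h1; have : K * C * r^-1 <= K * C * (2 * (m t)^-1).
    by rewrite ler_pM2l// !mulr_gt0.
  lra.
(* The lower bound needs K from [sum_Phi_le1] times 3C from [orlicz_le_Phi]; the upper one needs
   only 7 * 2C. *)
exists (3 * K * C) => [|n a an]; first by rewrite !mulr_gt0.
have C6 : 0 < 3 * K * C by rewrite !mulr_gt0.
have hF1 t : 0 < t <= 1 -> (C^-1%:E * (m t)^-1%:E <= F t)%E.
  by move=> t01; apply: (hC t _).1; rewrite /= in_itv.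
have hF2 t : 0 < t <= 1 -> (F t <= C%:E * (m t)^-1%:E)%E.
  by move=> t01; apply: (hC t _).2; rewrite /= in_itv.
have absE rho k : 0 < rho -> `|rho^-1 * a k| = `|a k| / rho.
  by move=> rho0; rewrite normrM gtr0_norm ?invr_gt0// mulrC.
split.
  have claim rho : 0 < rho -> (N n a <= rho%:E)%E ->
      (orlicz_norm M a <= (3 * K * C * rho)%:E)%E.
    move=> rho0 /(@sum_Phi_le1 _ _ _ rho0) h.
    apply: (orlicz_norm_le MO _ an); first by rewrite !mulr_gt0.
    apply: (le_trans _ h); apply: ler_sum => k _.
    have rho2 : 0 < K * rho by rewrite !mulr_gt0.
    rewrite -Phi_norm absE// (_ : 3 * K * C * rho = K * rho * (3 * C)); last by ring.
    rewrite invfM mulrA; apply: orlicz_le_Phi => //.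
      by rewrite divr_ge0// ltW.
    rewrite -absE// Phi_norm.
    exact: (@term_le1 n (fun k => Phi ((K * rho)^-1 * a k)) k _ h).
  rewrite lee_pdivrMl//; case Na : (N n a) => [r| |].
  (* [claim] wants a positive rho, but the norm may vanish, so a small amount is added to it. *)
  - apply/lee_addgt0Pr => e e0.
    have r0 : 0 <= r by rewrite -lee_fin -Na.
    have e6 : 0 < e / (3 * K * C) by rewrite divr_gt0.
    apply: (le_trans (claim (r + e / (3 * K * C)) _ _)); first lra.
      by rewrite Na lee_fin; lra.
    rewrite -EFinM -EFinD lee_fin mulrDr mulrCA mulfV ?mulr1// gt_eqF//.
  - by rewrite gt0_muley ?lte_fin// leey.
  - by have := N_ge0 n a; rewrite Na.
rewrite -lee_pdivrMl//; apply: (le_orlicz_norm MO an) => rho rho0 h.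
rewrite lee_pdivrMl// -EFinM.
have rho2 : 0 < 2 * C * rho by rewrite !mulr_gt0.
have : \sum_(k < n) Phi ((2 * C * rho)^-1 * a k) <= 1.
  apply: (le_trans _ h); apply: ler_sum => k _.
  rewrite -Phi_norm absE// invfM mulrA mulrAC; apply: Phi_le_orlicz => //.
    by rewrite divr_ge0// ltW.
  apply: (@term_le1 n (fun k => M (`|a k| / rho)) k) => // i.
  by rewrite (orlicz_ge0 MO)// divr_ge0// ltW.
move=> /(@N_le n (fun k => (2 * C * rho)^-1 * a k) _ rho2).
rewrite (_ : (fun k => _) = a); last first.
  by apply/funext => k; rewrite mulrA mulfV ?mul1r// gt_eqF.
move/le_trans; apply; rewrite lee_fin.
have : 5 * (C * rho) <= K * (C * rho) by rewrite ler_pM2r ?mulr_gt0.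
have : 0 < C * rho by rewrite !mulr_gt0.
lra.
Qed.

End orlicz_comparison.

(** * Norm bounds for linear combinations in L_p *)

Section Lnorm_lincomb.
Context (R : realType) (p : R) (d : measure_display) (T : measurableType d).
Context (P : probability T R) (X : nat -> {RV P >-> R}) (nu : probability R R).
Hypothesis p12 : 1 <= p <= 2.
Hypothesis nup : (\int[nu]_y (`|y| `^ p)%:E < +oo)%E.
Hypothesis nu0 : (\int[nu]_y y%:E = 0)%E.
Hypothesis indX : mutually_independent X.
Hypothesis Xnu :
  forall k B, measurable B -> distribution P (X k) B = nu B.

Let p0 : 0 < p. Proof. by case/andP: p12 => /(lt_le_trans ltr01). Qed.

Lemma Lnorm_le (S : T -> R) (c : R) : 0 <= c ->
  ('N[P]_(p%:E)[EFin \o S] <= c%:E)%E =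
  (\int[P]_w (`|S w| `^ p)%:E <= (c `^ p)%:E)%E.
Proof.
move=> c0; rewrite unlock.
rewrite -[X in (X `^ p^-1)%E]/(\int[P]_w (`|S w| `^ p)%:E)%E.
have := @poweR_mean_le R p 1 c (\int[P]_w (`|S w| `^ p)%:E)%E p0 ltr01 c0.
rewrite invr1 mul1e mul1r; apply.
by apply: integral_ge0 => w _; rewrite lee_fin powR_ge0.
Qed.

Let lincombZ (a : nat -> R) c n w :
  lincomb X (fun k => c * a k) n w = c * lincomb X a n w.
Proof. by rewrite /lincomb mulr_sumr; apply: eq_bigr => k _; rewrite mulrA. Qed.

Let integral_lincombZ (a : nat -> R) c n : 0 <= c ->
  (\int[P]_w (`|lincomb X (fun k => c * a k) n w| `^ p)%:E =
   (c `^ p)%:E * \int[P]_w (`|lincomb X a n w| `^ p)%:E)%E.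
Proof.
move=> c0; rewrite -ge0_integralZl//.
- apply: eq_integral => w _.
  by rewrite lincombZ normrM (ger0_norm c0) powRM// EFinM.
- apply/measurable_EFinP; apply: (measurableT_comp (measurable_norm_powR p)).
  exact: measurable_lincomb.
- by rewrite lee_fin powR_ge0.
Qed.

(** The p-th moment is at most 1 + 6 = 7, and 7 <= 7^p. *)
Lemma Lnorm_lincomb_le n (a : nat -> R) (rho : R) : 0 < rho ->
  \sum_(k < n) cut_moment nu p (a k) <= 1 ->
  ('N[P]_(p%:E)[EFin \o lincomb X (fun k => (rho * a k)%R) n] <=
   (7 * rho)%:E)%E.
Proof.
move=> rho0 h; rewrite Lnorm_le ?mulr_ge0 ?(ltW rho0)//.
rewrite integral_lincombZ ?(ltW rho0)// powRM ?(ltW rho0)// mulrC EFinM.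
rewrite lee_wpmul2l ?lee_fin ?powR_ge0//.
apply: le_trans (integral_lincomb_le p12 nup nu0 indX Xnu a n) _.
rewrite lee_fin; apply: (@le_trans _ _ 7); first lra.
by apply: le1r_powR; [lra|case/andP: p12].
Qed.

(** After division by 2000 rho the p-th moment is at most 2000^-p <= 1/2000, the threshold of
    [sum_cut_moment_le1]. *)
Lemma sum_cut_moment_le n (a : nat -> R) (rho : R) : 0 < rho ->
  ('N[P]_(p%:E)[EFin \o lincomb X a n] <= rho%:E)%E ->
  \sum_(k < n) cut_moment nu p ((2000 * rho)^-1 * a k) <= 1.
Proof.
move=> rho0; rewrite Lnorm_le ?(ltW rho0)// => h.
apply: (@sum_cut_moment_le1 _ _ _ _ _ _ _ p12 nup nu0 indX Xnu
  (fun k => (2000 * rho)^-1 * a k) n).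
have K0 : 0 <= (2000^-1 : R) by lra.
have r0 : 0 <= rho^-1 by rewrite invr_ge0 ltW.
rewrite invfM integral_lincombZ ?mulr_ge0//.
apply: (@le_trans _ _ (((2000^-1 * rho^-1) `^ p)%:E * (rho `^ p)%:E)%E).
  by rewrite lee_wpmul2l ?lee_fin ?powR_ge0.
rewrite -EFinM lee_fin powRM// -mulrA -powRM ?(ltW rho0)//.
rewrite mulVf ?gt_eqF// powR1 mulr1 ge1r_powR//; last by case/andP: p12.
apply/andP; split; lra.
Qed.

End Lnorm_lincomb.

(** * Proof of the equivalence *)

Lemma eq_asymp_on (R : realType) (D : set R) (F G H : R -> \bar R) :
  (forall t, D t -> G t = H t) -> asymp_on D F G <-> asymp_on D F H.
Proof.
by move=> GH; split=> -[C C0 h]; exists C => // t Dt;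
  [rewrite -GH// | rewrite GH//]; exact: h.
Qed.

Theorem proposition6 (R : realType) (p : R) (M f : R -> R)
    (d : measure_display) (T : measurableType d) (P : probability T R)
    (X : nat -> {RV P >-> R}) :
  1 <= p <= 2 ->
  orlicz_function M ->
  in_Lp01 p f ->
  mean_zero01 f ->
  independent_copies f X ->
  equiv_unit_basis p M X <->
  asymp_on `]0, 1]
    (fun t => ((orlicz_inv M t)^-1)%:E)
    (fun t =>
       ((t^-1)%:E * \int[@lebesgue_measure R]_(s in `[0%R, t])
                      (rearrangement f s `^ p)) `^ p^-1 +
       ((t^-1)%:E * \int[@lebesgue_measure R]_(s in `[t, 1%R])
                      (rearrangement f s `^ 2)) `^ 2^-1)%E.
Proof.
move=> p12 MO fLp f0 [indX copies].
have /andP[p1 p2] := p12.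
pose nu : probability R R := distribution P (X 0%N).
have m01 : measurable (`[0, 1]%classic : set R) by exact: measurable_itv.
have mf : measurable_fun (`[0, 1]%classic : set R) f.
  apply: (measurable_restrictT f m01).2.
  by move: (fLp); rewrite /in_Lp01 inE => /andP[/[!inE]/=].
have fnu B : measurable B ->
    lebesgue_measure (`[0, 1]%classic `&` f @^-1` B) = nu B.
  by move=> mB; rewrite -(copies 0%N).
have lawE h := @ge0_integral_law _ _ R lebesgue_measure _ f nu h m01 mf fnu.
have Xnu k B : measurable B -> distribution P (X k) B = nu B.
  by move=> mB; rewrite copies// fnu.
have nup : (\int[nu]_y (`|y| `^ p)%:E < +oo)%E.
  rewrite -(lawE (fun y => (`|y| `^ p)%:E)); last 2 first.
  - by apply/measurable_EFinP; exact: measurable_norm_powR.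
  - by move=> y; rewrite lee_fin powR_ge0.
  apply: le_lt_trans (integrable_lty measurableT (Lfun_integrable p1 fLp)).
  rewrite [leLHS](_ : _ = \int[lebesgue_measure]_(u in `[0%R, 1%R])
      (`|(f \_ `[0, 1]) u| `^ p)%:E)%E; last first.
    by apply: eq_integral => u u01; rewrite patchE u01.
  have mf01 : measurable_fun setT (f \_ `[0, 1]) by exact: (measurable_restrictT f m01).1 mf.
  apply: (@ge0_subset_integral _ _ _ lebesgue_measure _ _ m01 measurableT) => //.
  by apply/measurable_EFinP; exact: (measurableT_comp (measurable_norm_powR p)).
have nu0 : (\int[nu]_y y%:E = 0)%E.
  have mE : measurable_fun setT (EFin : R -> \bar R) by [].
  (* The transfer to the law is available for nonnegative functions, so the mean is split into
     positive and negative parts. *)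
  have hp := lawE (EFin : R -> \bar R)^\+%E (measurable_funepos mE) (funepos_ge0 _).
  have hn := lawE (EFin : R -> \bar R)^\-%E (measurable_funeneg mE) (funeneg_ge0 _).
  rewrite -f0 /mean_zero01 [RHS]integralE [LHS]integralE.
  congr (_ - _)%E.
    by rewrite -hp; apply: eq_integral => x _; rewrite !funeposE.
  by rewrite -hn; apply: eq_integral => x _; rewrite !funenegE.
(* The tail function of |X_0| is n_f, so |X_0| realizes the distribution of f^*. *)
pose Y : {RV P >-> R} := HB.pack (fun w => `|X 0%N w|)
  (isMeasurableFun.Build _ _ _ _ _
    (measurableT_comp (@normr_measurable R setT) (measurable_funPT (X 0%N)))).
have Y0 w : 0 <= Y w by exact: normr_ge0.
have ccdfY t : ccdf Y t = distr_fun f t.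
  have mt : measurable [set y : R | t < `|y|].
    rewrite (_ : [set _ | _] = setT `&` (fun y : R => `|y|) @^-1` `]t, +oo[%classic); last first.
      by apply/seteqP; split => y /=; rewrite in_itv/= andbT// => -[].
    exact: (@normr_measurable R setT measurableT _ (measurable_itv _)).
  rewrite /ccdf /distr_fun.
  have -> : distribution P Y `]t, +oo[ = nu [set y | t < `|y|].
    by congr (P _); apply/seteqP; split => w /=; rewrite in_itv/= andbT.
  by rewrite -fnu.
pose G := rearrangementr f.
have mG : measurable_fun (`]0, 1]%classic : set R) G := measurable_rearrangementr ccdfY.
have G0 s : 0 <= G s := rearrangementr_ge0 f s.
have G_homo s t : 0 < s -> s <= t -> G t <= G s.
  exact: (rearrangementr_homo ccdfY).
have Gnu x : (\int[lebesgue_measure]_(s in `]0%R, 1%R]) (cutpow p (x * G s))%:E =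
    (cut_moment nu p x)%:E)%E.
  have mc := measurable_cutpowM p x.
  have c0 y : (0 <= (cutpow p (x * y))%:E)%E by rewrite lee_fin cutpow_ge0.
  rewrite (@ge0_integral_law _ _ R lebesgue_measure _ G (distribution P Y)
    (fun y => (cutpow p (x * y))%:E) (measurable_itv _) mG
    (rearrangementr_law Y0 ccdfY))//.
  apply: etrans (cut_momentE nup x).
  rewrite (ge0_integral_distribution Y mc c0).
  rewrite [RHS](ge0_integral_distribution (X 0%N) mc c0).
  apply: eq_integral => w _ /=.
  (* phi is even, so |X_0| may replace X_0. *)
  by rewrite -cutpow_norm -[in RHS]cutpow_norm !normrM normr_id.
have FE t : `]0, 1]%classic t ->
    (((t^-1)%:E * \int[@lebesgue_measure R]_(s in `[0%R, t])
                      (rearrangement f s `^ p)) `^ p^-1 +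
       ((t^-1)%:E * \int[@lebesgue_measure R]_(s in `[t, 1%R])
                      (rearrangement f s `^ 2)) `^ 2^-1)%E = mixed_average p G t.
  rewrite /= in_itv/= => /andP[t0 t1].
  have GE r s : 0 < s -> (rearrangement f s `^ r = (G s `^ r)%:E)%E.
    by move=> s0; rewrite (rearrangementrE ccdfY s0).
  have mGr r (a b : R) : 0 <= a -> b <= 1 ->
      measurable_fun (`]a, b]%classic : set R) (fun s => rearrangement f s `^ r)%E.
    move=> a0 b1; apply: (eq_measurable_fun (fun s => (G s `^ r)%:E)).
      by move=> s; rewrite inE/= in_itv/= => /andP[/(le_lt_trans a0) s0 _]; rewrite GE.
    apply/measurable_EFinP; apply: (measurableT_comp (measurable_powR r)).
    apply: measurable_funS mG; first exact: measurable_itv.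
    by apply: subset_itv; rewrite bnd_simp.
  congr (_ `^ _ + _ `^ _)%E; congr (_ * _)%E.
    (* The left endpoint is dropped as a null set: at 0 the rearrangement may be +oo, and its real
       version is faithful only for s > 0. *)
    rewrite -integral_itv_obnd_cbnd; last exact: mGr.
    by apply: eq_integral => s; rewrite inE/= in_itv/= => /andP[s0 _]; rewrite GE.
  rewrite -integral_itv_obnd_cbnd; last by apply: mGr => //; exact: ltW.
  apply: eq_integral => s; rewrite inE/= in_itv/= => /andP[/(lt_trans t0) s0 _].
  by rewrite GE// powR_mulrn.
apply: iff_trans; last by apply: iff_sym; apply: eq_asymp_on FE.
apply: (@orlicz_comparison R M (cut_moment nu p) (mixed_average p G)
  (fun n a => 'N[P]_(p%:E)[EFin \o lincomb X a n])%E MO _ _ _ _ _ 2000).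
- exact: cut_moment_norm.
- exact: cut_moment_ge0.
- exact: cut_moment_scale.
- by move=> t x t01 x0; exact: (mixed_average_le_of_cut_moment p12 mG G0 G_homo Gnu).
- by move=> t x t01 x0; exact: (cut_moment_le_of_mixed_average p12 mG G0 Gnu).
- lra.
- by move=> n a; exact: Lnorm_ge0.
- by move=> n a rho; exact: Lnorm_lincomb_le.
- by move=> n a rho; exact: sum_cut_moment_le.
Qed.
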